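(* Let $\Phi$ be an irreducible crystallographic root system of rank $n$ with affine Weyl group $\widetilde W$ and Coxeter number $h$, and let $b$ be a positive integer with $\gcd(h,b)=1$. Then $$\max_{q\in\mathcal S(b)\cap\check{\mathcal Q}}\check{\mathrm{size}}(q)=\frac{r\,\check g}{h}\cdot\frac{n(b^2-1)(h+1)}{24}.$$ Moreover, this maximum is attained at a unique point $q_*\in\mathcal S(b)\cap\check{\mathcal Q}$.
   Context: $\Phi$ is a reduced irreducible crystallographic root system spanning an $n$-dimensional Euclidean space $V$, with simple roots $\alpha_1,\dots,\alpha_n$. The height of $\alpha=\sum a_i\alpha_i\in\Phi$ is $\mathrm{ht}(\alpha)=\sum a_i$. The highest root is $\tilde\alpha=\sum_{i=1}^n c_i\alpha_i$, and the Coxeter number is $h=1+\sum_{i=1}^n c_i$. The inner product is normalized so that $\langle\tilde\alpha,\tilde\alpha\rangle=2$; roots with $\langle\alpha,\alpha\rangle=2$ are long, all others are short. The coroot of $\alpha$ is $\check\alpha=2\alpha/\langle\alpha,\alpha\rangle$; if there are short roots then $\check\alpha=r\alpha$ for every short $\alpha$, with $r\in\{2,3\}$ (the ratio of squared lengths of long and short roots); otherwise $r=1$. $\check\Phi=\{\check\alpha:\alpha\in\Phi\}$ is the dual root system. $\check g$: let $\theta\in\Phi$ be the root whose coroot is the highest root of $\check\Phi$ (the highest short root of $\Phi$ if $\Phi$ is not simply-laced, and $\theta=\tilde\alpha$ if it is). Then $\check g=1+\mathrm{ht}(\theta)$, the dual Coxeter number of $\check\Phi$. Explicitly $\check g=h$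 in simply-laced types, $n+1$ for $B_n$, $2n-1$ for $C_n$, $9$ for $F_4$, $4$ for $G_2$. $\check{\mathcal Q}$ is the lattice generated by $\check\Phi$. The fundamental coweights $\check\omega_1,\dots,\check\omega_n$ form the basis of $V$ dual to the simple roots, and $\check\rho=\sum_i\check\omega_i$. For $q\in\check{\mathcal Q}$, $\check{\mathrm{size}}(q)=\langle \tfrac h2 q-\check\rho,\,q\rangle$. For $b$ coprime to $h$, write $b=t_bh+r_b$ with integers $t_b\ge 0$, $0<r_b<h$. With $\Phi_i$ the set of roots of height $i$, the $b$-Sommers region is $$\mathcal S(b)=\{x\in V:\langle x,\alpha\rangle\ge -t_b\ \forall\alpha\in\Phi_{r_b},\ \ \langle x,\alpha\rangle\le t_b+1\ \forall\alpha\in\Phi_{h-r_b}\}.$$ *)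

(* Defs.v *)
From mathcomp Require Import all_boot all_order all_algebra.
From mathcomp Require Import classical_sets reals.

Set Implicit Arguments.
Unset Strict Implicit.
Unset Printing Implicit Defensive.

Import Order.TTheory GRing.Theory Num.Theory.
Local Open Scope ring_scope.
Local Open Scope classical_set_scope.

(* A Euclidean space is a finite-dimensional real vector space [V] with an
   inner product [dot : {dot V for idfun}] (a positive definite symmetric
   bilinear form).  A finite set of vectors is given by a sequence listing its
   elements; no definition depends on the order or on repetitions. *)
Section RootSystems.
Variables (R : realType) (V : vectType R) (dot : {dot V for idfun}).
Implicit Types (Phi : seq V) (a b q x : V).

Definition coroot a : V := (2 / dot a a) *: a.

Definition reflection a x : V := x - dot x (coroot a) *: a.

Definition coroots Phi : seq V := [seq coroot a | a <- Phi].

Record root_system Phi : Prop := RootSystem {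
  root_neq0 : 0 \notin Phi;
  root_span : (<<Phi>>%VS = fullv);
  root_reflection : forall a b, a \in Phi -> b \in Phi -> reflection a b \in Phi;
  root_crystallographic :
    forall a b, a \in Phi -> b \in Phi -> dot b (coroot a) \is a Num.int;
  root_reduced :
    forall a (c : R), a \in Phi -> c *: a \in Phi -> c = 1 \/ c = -1
}.

(* [Phi] is nonempty and not the union of two nonempty subsets that are
   orthogonal to each other. *)
Definition irreducible_roots Phi : Prop :=
  (exists a, a \in Phi) /\
  forall P : pred V,
    (exists2 a, a \in Phi & P a) -> (exists2 b, b \in Phi & ~~ P b) ->
    exists a b, [/\ a \in Phi, P a, b \in Phi, ~~ P b & dot a b != 0].

Section Base.
Variables (n : nat) (Delta : n.-tuple V).

(* Every root has, in the basis [Delta], natural coordinates or the opposites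
   of natural coordinates. *)
Record simple_roots Phi : Prop := SimpleRoots {
  simple_sub : {subset Delta <= Phi};
  simple_basis : basis_of fullv Delta;
  simple_sign : forall a, a \in Phi ->
    (forall i, coord Delta i a \is a Num.nat) \/
    (forall i, - coord Delta i a \is a Num.nat)
}.

Definition height x : R := \sum_(i < n) coord Delta i x.

Definition highest_root Phi a : Prop :=
  a \in Phi /\ forall b, b \in Phi -> height b <= height a.

Definition fundamental_coweights (omega : n.-tuple V) : Prop :=
  basis_of fullv omega /\
  forall i j, dot (tnth omega i) (tnth Delta j) = (i == j)%:R.

(* Writing [b = t_b * h + r_b], [t_b] is [b %/ h] and [r_b] is [b %% h]. *)
Definition sommers Phi (h b : nat) : set V :=
  [set x | (forall a, a \in Phi -> height a = (b %% h)%N%:R ->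
              dot x a >= - (b %/ h)%N%:R) /\
           (forall a, a \in Phi -> height a = (h - b %% h)%N%:R ->
              dot x a <= (b %/ h)%N%:R + 1)].

End Base.

(* Roots of squared length 2 are long (the highest root being normalized to
   squared length 2), all others are short. *)
Definition long a : bool := dot a a == 2.

Definition lacing_ratio Phi (r : R) : Prop :=
  if all long Phi then r = 1
  else forall a, a \in Phi -> ~~ long a -> coroot a = r *: a.

Definition coroot_lattice Phi : set V :=
  [set q | inIntSpan (in_tuple (coroots Phi)) q].

Definition rho_check n (omega : n.-tuple V) : V := \sum_(i < n) tnth omega i.

Definition size_check (h : nat) (rho q : V) : R :=
  dot ((h%:R / 2) *: q - rho) q.

End RootSystems.

Definition is_maximum (R : realType) (A : set R) (m : R) : Prop :=
  A m /\ ubound A m.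

(* Main.v *)
From HB Require Import structures.
Require Import Defs.
From mathcomp Require Import all_boot all_order all_algebra.
From mathcomp Require Import classical_sets reals.
From mathcomp Require Import zify ring lra.

Set Implicit Arguments.
Unset Strict Implicit.
Unset Printing Implicit Defensive.

Import Order.TTheory GRing.Theory Num.Theory.
Local Open Scope ring_scope.
Local Open Scope classical_set_scope.

(** Write [c = rho / h] for the centre of the fundamental alcove, where [rho] is
    the sum of the fundamental coweights.  Completing the square,
    [size q = h/2 |q - c|^2 - |rho|^2 / (2 h)], so the size is maximal at the
    lattice points of the region that are farthest from [c].

    The point [b c] lies on no affine root hyperplane, because [b] is prime to
    [h] and the heights of the roots are smaller than [h].  Hence an element of
    the affine Weyl group carries it into the open fundamental alcove; there the
    simple roots take positive values in [Z / h] whose combination with the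
    coefficients of the highest root is less than 1, which forces the image to be
    [c] ([integral_alcove], [affine_transport]).  The inverse [w] of this element
    maps [c] to [b c], preserves the coroot lattice, and maps the Sommers region,
    which is cut out by the affine roots of value [b / h] at [c], onto the dilated
    alcove [0 <= <y,alpha_i>], [<y,alpha~> <= b] ([sommersP], [sommers_dilated],
    [sommers_zero]).  For [y = w q] the size of [q] becomes

      [(b^2 - 1) |rho|^2 / (2 h) - (2 b <rho,y> - h |y|^2) / 2].

    Now [2 h |y|^2] and [4 <rho,y>] are the sums over all roots [a] of
    [2 / |a|^2] times [<y,a>^2], respectively times [|<y,a>|], and [|<y,a>| <= b]
    on the dilated alcove.  So the term subtracted is nonnegative, term by term.
    If it vanishes then all the values [<y,a>] are 0, [b] or [- b], so that
    [z = y / b] is a minuscule coweight.  As [h z] belongs to the coroot lattice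
    for every coweight [z], and so does [b z = y], also [z] does; and a minuscule
    coweight in the coroot lattice is zero ([minuscule_eq0],
    [dilated_alcove_norm]).  The maximum is thus reached exactly at the point of
    the region that [w] maps to 0.

    It remains to evaluate [|rho|^2] by the strange formula
    [|rho|^2 = r g n (h + 1) / 12] ([strange_formula]).  It rests on one fact on
    an arbitrary root system ([strange_sum]).  Expand the squared norm of the sum
    of the positive roots into products [<a,b> s_a s_b], where [s] is the sign of
    a root.  Each [- <a,b>] is a difference of two weights attached to the triples
    of roots [(a, b, - (a + b))] and [(a, - b, b - a)] of sum zero, the weights
    being symmetric functions of the triple (they are squares of structure
    constants of the Lie algebra).  In a triple of sum zero two roots have one
    sign and the third has the other, so the three products of signs always add
    up to -1.  The sum of all the products is therefore expressed through the sum
    of all weights, which is a second moment of the root system.  Irreducibility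
    makes the second moments multiples of the inner product
    ([invariant_form]); the factors are computed at the highest root, whose
    pairings with the other positive roots are 0 or 1 ([highest_root_sum]), and
    the trace gives the number [n h] of roots ([form_trace]). *)

(** * Inner products and reflections *)

Section InnerProduct.
Variables (R : realType) (V : vectType R) (dot : {dot V for idfun}).
Implicit Types (a b x y z : V) (c : R).

Lemma dotC x y : dot x y = dot y x.
Proof. by rewrite hermC expr0 mul1r. Qed.

Lemma dotDl x y z : dot (x + y) z = dot x z + dot y z.
Proof. exact: linearDl. Qed.

Lemma dotDr x y z : dot z (x + y) = dot z x + dot z y.
Proof. exact: linearDr. Qed.

Lemma dotNl x z : dot (- x) z = - dot x z.
Proof. exact: linearNl. Qed.

Lemma dotNr x z : dot z (- x) = - dot z x.
Proof. exact: linearNr. Qed.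

Lemma dotZl c x z : dot (c *: x) z = c * dot x z.
Proof. exact: linearZl_LR. Qed.

Lemma dotZr c x z : dot z (c *: x) = c * dot z x.
Proof. exact: linearZr_LR. Qed.

Lemma dot0l z : dot 0 z = 0.
Proof. exact: linear0l. Qed.

Lemma dot0r z : dot z 0 = 0.
Proof. exact: linear0r. Qed.

Lemma dot_coroot x a : dot x (coroot dot a) = 2 * dot x a / dot a a.
Proof. by rewrite dotZr; ring. Qed.

Lemma dot_corootl x a : dot (coroot dot a) x = 2 * dot a x / dot a a.
Proof. by rewrite dotZl; ring. Qed.

(* the rules for coroots come first, since a coroot is a scaled vector *)
Definition dotE := (dot_coroot, dot_corootl,
  dotDl, dotDr, dotNl, dotNr, dotZl, dotZr, dot0l, dot0r).

Lemma dot_suml (I : Type) (s : seq I) (P : pred I) (F : I -> V) z :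
  dot (\sum_(i <- s | P i) F i) z = \sum_(i <- s | P i) dot (F i) z.
Proof. exact: linear_sumlz. Qed.

Lemma dot_sumr (I : Type) (s : seq I) (P : pred I) (F : I -> V) z :
  dot z (\sum_(i <- s | P i) F i) = \sum_(i <- s | P i) dot z (F i).
Proof. exact: linear_sumr. Qed.

Lemma dot_gt0 x : x != 0 -> 0 < dot x x.
Proof. exact: neq0_dnorm_gt0. Qed.

Lemma dot_ge0 x : 0 <= dot x x.
Proof.
by have [->|/dot_gt0/ltW //] := eqVneq x 0; rewrite dot0l.
Qed.

Lemma dot_eq0 x : (dot x x == 0) = (x == 0).
Proof.
have [->|x0] := eqVneq x 0; first by rewrite dot0l eqxx.
by rewrite gt_eqF // dot_gt0.
Qed.

Lemma dot_basis_eq n (E : n.-tuple V) x y : basis_of fullv E ->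
  (forall i, dot x (tnth E i) = dot y (tnth E i)) -> x = y.
Proof.
move=> bE Exy; apply/eqP; rewrite -subr_eq0 -dot_eq0.
rewrite {2}(coord_basis bE (memvf (x - y))) dot_sumr big1 // => i _.
by rewrite -tnth_nth dotZr !dotE Exy subrr mulr0.
Qed.

Lemma cauchy_schwarz x y :
  dot x y ^+ 2 <= dot x x * dot y y ?= iff (dot y y *: x == dot x y *: y).
Proof.
have [->|y0] := eqVneq y 0.
  by rewrite !dotE expr0n mulr0 /= scale0r scaler0; apply/leifP; rewrite eqxx.
have yy : 0 < dot y y by apply: dot_gt0.
have id : dot (dot y y *: x - dot x y *: y) (dot y y *: x - dot x y *: y)
   = dot y y * (dot x x * dot y y - dot x y ^+ 2).
  by rewrite !dotE (dotC y x); ring.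
split; first by rewrite -subr_ge0 -(pmulr_rge0 _ yy) -id dot_ge0.
by rewrite -[RHS]subr_eq0 -dot_eq0 id mulf_eq0 (gt_eqF yy) subr_eq0 eq_sym.
Qed.

Lemma reflection_is_linear a : linear (reflection dot a).
Proof.
move=> c x y; rewrite /reflection dotDl dotZl scalerDl scalerBr !opprD scalerA.
by rewrite addrACA.
Qed.

HB.instance Definition _ a :=
  GRing.isLinear.Build R V V *:%R (reflection dot a) (reflection_is_linear a).

Lemma dot_reflection a x y :
  dot (reflection dot a x) (reflection dot a y) = dot x y.
Proof.
have [->|a0] := eqVneq a 0; first by rewrite /reflection !scaler0 !subr0.
have := dot_gt0 a0; rewrite /reflection !dotE (dotC a y) => aa.
by field; rewrite gt_eqF.
Qed.

Lemma reflectionK a : involutive (reflection dot a).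
Proof.
have [->|a0 x] := eqVneq a 0.
  by move=> x; rewrite /reflection !scaler0 !subr0.
have aa := dot_gt0 a0.
rewrite /reflection !dotE -addrA -opprD -scalerDl.
rewrite [X in X *: a](_ : _ = 0) ?scale0r ?subr0 //.
by field; rewrite gt_eqF.
Qed.

Lemma dot_reflection_adj a x y :
  dot (reflection dot a x) y = dot x (reflection dot a y).
Proof. by rewrite -{1}[y](reflectionK a) dot_reflection. Qed.

Lemma reflection_self a : reflection dot a a = - a.
Proof.
have [->|a0] := eqVneq a 0; first by rewrite /reflection scaler0 subr0 oppr0.
have aa := dot_gt0 a0.
rewrite /reflection dot_coroot (_ : _ / _ = 2); last by field; rewrite gt_eqF.
by rewrite -[X in X - _]scale1r -scalerBl -scaleN1r; congr (_ *: _); ring.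
Qed.

Lemma coroot_reflection a b :
  coroot dot (reflection dot a b) = reflection dot a (coroot dot b).
Proof. by rewrite /coroot dot_reflection linearZ /=. Qed.

Lemma reflection_coroot a x : reflection dot (coroot dot a) x = reflection dot a x.
Proof.
have [->|a0] := eqVneq a 0; first by rewrite /coroot scaler0.
have aa := dot_gt0 a0.
rewrite /reflection !dotE /coroot !scalerA; congr (_ - _ *: _).
by field; rewrite gt_eqF.
Qed.

Lemma corootK : involutive (coroot dot).
Proof.
move=> a; have [->|a0] := eqVneq a 0; first by rewrite /coroot !scaler0.
have aa := dot_gt0 a0.
rewrite /coroot !dotE scalerA (_ : _ * _ = 1) ?scale1r //.
by field; rewrite gt_eqF.
Qed.

Lemma corootN a : coroot dot (- a) = - coroot dot a.
Proof. by rewrite /coroot !dotE opprK scalerN. Qed.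

Lemma coroot_eq0 a : (coroot dot a == 0) = (a == 0).
Proof.
have [->|a0] := eqVneq a 0; first by rewrite /coroot scaler0 eqxx.
have aa := dot_gt0 a0.
by rewrite /coroot scaler_eq0 (negbTE a0) orbF mulf_eq0 invr_eq0 (gt_eqF aa)
  pnatr_eq0.
Qed.

End InnerProduct.

(** * Root systems *)

Lemma int_pair_lt4 (R : realType) (x y : R) : x \is a Num.int -> y \is a Num.int ->
  0 < x -> 0 < y -> x * y < 4 -> x = 1 \/ y = 1.
Proof.
move=> /intrP[i ->] /intrP[j ->]; rewrite !ltr0z -intrM -[4]/(4%:~R) ltr_int.
move=> i0 j0 ij; have : i = 1 \/ j = 1 by nia.
by case=> ->; [left|right].
Qed.

Section RootSystem.
Variables (R : realType) (V : vectType R) (dot : {dot V for idfun}).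
Variable Psi : seq V.
Hypotheses (Psi_root : root_system dot Psi) (Psi_uniq : uniq Psi).
Implicit Types (a b x y z : V).

Local Notation refl := (reflection dot).

Lemma root_nz a : a \in Psi -> a != 0.
Proof. by move=> aP; apply: contraNneq (root_neq0 Psi_root) => <-. Qed.

Lemma root_dot_gt0 a : a \in Psi -> 0 < dot a a.
Proof. by move/root_nz; apply: dot_gt0. Qed.

Lemma root_opp a : a \in Psi -> - a \in Psi.
Proof.
by move=> aP; rewrite -(reflection_self dot); apply: (root_reflection Psi_root).
Qed.

Lemma root_oppE a : (- a \in Psi) = (a \in Psi).
Proof. by apply/idP/idP => /root_opp //; rewrite opprK. Qed.

Lemma root_reflE a b : a \in Psi -> (refl a b \in Psi) = (b \in Psi).
Proof.
move=> aP; apply/idP/idP => [bP|]; last exact: (root_reflection Psi_root).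
by rewrite -[b](reflectionK dot a); apply: (root_reflection Psi_root).
Qed.

Lemma root_subC a b : (a - b \in Psi) = (b - a \in Psi).
Proof. by rewrite -opprB root_oppE. Qed.

Lemma sum_root_bij (U : zmodType) (f : V -> V) (F : V -> U) :
  {in Psi, forall a, f a \in Psi} -> {in Psi, involutive f} ->
  \sum_(a <- Psi) F (f a) = \sum_(a <- Psi) F a.
Proof.
move=> fP fK; rewrite -[LHS](big_map f xpredT); apply: perm_big.
apply: uniq_perm => //.
  rewrite map_inj_in_uniq // => a b aP bP /(congr1 f).
  by rewrite !fK.
move=> a; apply/mapP/idP => [[b bP ->]|aP]; first exact: fP.
by exists (f a); [apply: fP|rewrite fK].
Qed.

Lemma sum_root_opp (U : zmodType) (F : V -> U) :
  \sum_(a <- Psi) F (- a) = \sum_(a <- Psi) F a.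
Proof. by apply: sum_root_bij => [a /root_opp|a _]; rewrite ?opprK. Qed.

Lemma sum_root_refl b (F : V -> R) : b \in Psi ->
  \sum_(a <- Psi) F (refl b a) = \sum_(a <- Psi) F a.
Proof.
move=> bP; apply: sum_root_bij => [a aP|a _]; last exact: reflectionK.
exact: (root_reflection Psi_root).
Qed.

Lemma root_oppF a : a \in Psi -> (- a == a) = false.
Proof.
move=> /root_dot_gt0 aa; apply/eqP => E.
by have : dot a a = - dot a a; [rewrite -{1}E dotNl|lra].
Qed.

Lemma sum_root_pm a (F : V -> R) : a \in Psi ->
  \sum_(b <- Psi) F b =
  F a + F (- a) + \sum_(b <- Psi | (b != - a) && (b != a)) F b.
Proof.
move=> aP; rewrite (bigD1_seq a) //= big_mkcond (bigD1_seq (- a)) ?root_opp //=.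
by rewrite root_oppF //= addrA -big_mkcondr.
Qed.

(** The product is four times the squared cosine of the angle between [a] and
    [b], which are not proportional because the root system is reduced. *)
Lemma pairing_lt4 a b : a \in Psi -> b \in Psi -> b != a -> b != - a ->
  dot a (coroot dot b) * dot b (coroot dot a) < 4.
Proof.
move=> aP bP ba bNa.
have aa := root_dot_gt0 aP; have bb := root_dot_gt0 bP.
rewrite !dot_coroot (dotC dot b a).
suff lt : dot a b ^+ 2 < dot a a * dot b b.
  rewrite (_ : _ * _ = 4 * dot a b ^+ 2 / (dot a a * dot b b)); last first.
    by field; rewrite !gt_eqF.
  rewrite ltr_pdivrMr ?mulr_gt0 //; lra.
rewrite (lt_leif (cauchy_schwarz dot a b)); apply/negP => /eqP E.
have {}E : a = (dot a b / dot b b) *: b.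
  by rewrite mulrC -scalerA -E scalerA mulVf ?scale1r ?gt_eqF.
have [] := root_reduced Psi_root bP (c := dot a b / dot b b); rewrite -?E //.
  by move=> E1; move: ba; rewrite E E1 scale1r eqxx.
by move=> E1; move: bNa; rewrite E E1 scaleN1r opprK eqxx.
Qed.

Lemma sub_root a b : a \in Psi -> b \in Psi -> 0 < dot a b -> a != b ->
  a - b \in Psi.
Proof.
move=> aP bP ab neq; have aa := root_dot_gt0 aP; have bb := root_dot_gt0 bP.
have bNa : b != - a by apply: contraTneq ab => ->; rewrite dotNr; lra.
rewrite eq_sym in neq; have lt4 := pairing_lt4 aP bP neq bNa.
have m0 : 0 < dot a (coroot dot b).
  by rewrite dot_coroot divr_gt0 // mulr_gt0.
have m1 : 0 < dot b (coroot dot a).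
  by rewrite dot_coroot dotC divr_gt0 // mulr_gt0.
have [E|E] := int_pair_lt4 (root_crystallographic Psi_root bP aP)
  (root_crystallographic Psi_root aP bP) m0 m1 lt4.
  by have := root_reflection Psi_root bP aP; rewrite /reflection E scale1r.
rewrite root_subC.
by have := root_reflection Psi_root aP bP; rewrite /reflection E scale1r.
Qed.

Lemma add_root a b : a \in Psi -> b \in Psi -> dot a b < 0 -> a != - b ->
  a + b \in Psi.
Proof.
move=> aP bP ab neq; rewrite -[b]opprK; apply: sub_root; rewrite ?root_opp //.
by rewrite dotNr oppr_gt0.
Qed.

Lemma pairing_cases a b : a \in Psi -> b \in Psi -> b != a -> b != - a ->
  exists2 i : int, dot b (coroot dot a) = i%:~R & (`|i| <= 3)%N.
Proof.
move=> aP bP ba bNa; have lt4 := pairing_lt4 aP bP ba bNa.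
have aa := root_dot_gt0 aP; have bb := root_dot_gt0 bP.
have /intrP[i Ei] := root_crystallographic Psi_root aP bP.
have /intrP[j Ej] := root_crystallographic Psi_root bP aP.
exists i => //.
have ij0 : (j == 0) = (i == 0).
  rewrite -(intr_eq0 R j) -(intr_eq0 R i) -Ei -Ej !dot_coroot (dotC dot b a).
  by rewrite !mulf_eq0 !invr_eq0 (gt_eqF aa) (gt_eqF bb).
have ij : 0 <= j * i.
  rewrite -(ler0z R) intrM -Ei -Ej !dot_coroot (dotC dot b a) mulrACA.
  by rewrite -expr2 mulr_ge0 ?sqr_ge0 // mulr_ge0 // invr_ge0 ltW.
move: lt4 ij0 ij; rewrite Ei Ej -intrM -[4]/(4%:~R) ltr_int; clear; nia.
Qed.

(** The root [a + b] pairs to 2 with the coroot of [a], so its squared norm is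
    twice that of [a]; by symmetry it is also twice that of [b].  This is the
    configuration of two short roots in type [B2]. *)
Lemma orth_add_root_norm a b : a \in Psi -> b \in Psi -> dot a b = 0 ->
  a + b \in Psi -> dot a a = dot b b.
Proof.
move=> aP bP ab abP; have aa := root_dot_gt0 aP; have bb := root_dot_gt0 bP.
have nab : dot (a + b) (a + b) = dot a a + dot b b.
  by rewrite !dotE (dotC dot b a) ab; ring.
(* x + y pairs to 2 with the coroot of x, so x pairs to 1 with that of x + y *)
have half x y : x \in Psi -> y \in Psi -> dot x y = 0 -> x + y \in Psi ->
    dot (x + y) (x + y) = 2 * dot x x.
  move=> xP yP xy xyP; have xx := root_dot_gt0 xP; have yy := root_dot_gt0 yP.
  have nx : x + y != x.
    by apply/eqP => /(congr1 (dot y)); rewrite !dotE (dotC dot y x) xy; lra.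
  have nNx : x + y != - x.
    apply/eqP => /(congr1 (dot x)); rewrite !dotE xy; lra.
  have pxy := root_dot_gt0 xyP.
  have lt4 := pairing_lt4 xP xyP nx nNx.
  have E2 : dot (x + y) (coroot dot x) = 2.
    by rewrite !dotE (dotC dot y x) xy; field; rewrite gt_eqF.
  have := root_crystallographic Psi_root xyP xP.
  rewrite E2 in lt4; move=> /intrP[i Ei]; rewrite Ei in lt4.
  have i0 : 0 < i.
    rewrite -(ltr0z R) -Ei dot_coroot divr_gt0 // mulr_gt0 // !dotE xy; lra.
  have lt2 : i < 2 by rewrite -(ltr_int R); lra.
  have i1 : i = 1 by move: i0 lt2; clear; lia.
  move: Ei; rewrite i1 dot_coroot dotDr xy addr0.
  move=> /(congr1 (fun t => t * dot (x + y) (x + y))).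
  by rewrite divfK ?gt_eqF // mul1r.
have := half a b aP bP ab abP; rewrite addrC in abP.
have ba : dot b a = 0 by rewrite dotC.
have := half b a bP aP ba abP; rewrite addrC nab; lra.
Qed.

End RootSystem.
(** * Triples of roots of sum zero *)

Section Weights.
Variables (R : realType) (V : vectType R) (dot : {dot V for idfun}).
Variable Psi : seq V.
Hypotheses (Psi_root : root_system dot Psi) (Psi_uniq : uniq Psi).
Implicit Types (a b x y z : V).

Local Notation refl := (reflection dot).

(** This is [q (p + 1) |a|^2 / 2], where [b - p a, ..., b + q a] is the
    [a]-string through [b]: up to sign, the square of the structure constant
    [N_(a,b)] for root vectors such that [e_a], [e_(-a)] have bracket [a].  It
    is written by cases to make its symmetry in [a] and [b] visible; the third
    case occurs in type [B2], and the last two in type [G2]. *)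
Definition triple_weight a b : R :=
  if a + b \notin Psi then 0
  else if a - b \notin Psi then - dot a b
  else if dot a b == 0 then dot a a
  else if dot a b < 0 then - 4 * dot a b else 3 * dot a b.

Local Notation w := triple_weight.

Lemma triple_weight0 a b : a + b \notin Psi -> w a b = 0.
Proof. by rewrite /w => ->. Qed.

Lemma triple_weightC a b : a \in Psi -> b \in Psi -> w a b = w b a.
Proof.
move=> aP bP; rewrite /w (addrC b a) (root_subC Psi_root b a) (dotC dot b a).
case: ifPn => // /negPn abP; do 2 case: ifPn => //.
move/eqP => ab _; exact: (orth_add_root_norm Psi_root).
Qed.

(** In terms of the string this is [p (q + 1) - q (p + 1) = p - q], which is
    [<b,a^v>], times [|a|^2 / 2]. *)
Lemma triple_weightB a b : a \in Psi -> b \in Psi -> b != a -> b != - a ->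
  w a (- b) - w a b = dot a b.
Proof.
move=> aP bP ba bNa; rewrite /w opprK dotNr oppr_eq0 oppr_lt0.
case: (boolP (a + b \in Psi)) => abP; case: (boolP (a - b \in Psi)) => amP /=.
- by case: (ltgtP (dot a b) 0) => [h|h|h] /=; lra.
- by ring.
- by ring.
- rewrite subr0; case: (ltgtP (dot a b) 0) => [h|h|//].
    by case/negP: abP; apply: (add_root Psi_root) => //; rewrite -eqr_oppLR eq_sym.
  by case/negP: amP; apply: (sub_root Psi_root) => //; rewrite eq_sym.
Qed.

(** Negation reverses the [a]-strings, so the string through
    [- (a + b)] extends [q - 1] steps down and [p + 1] steps up, and
    [(p + 1) ((q - 1) + 1) = q (p + 1)]. *)
Lemma triple_weight_string a b : a \in Psi -> b \in Psi -> a + b \in Psi ->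
  w a (- (a + b)) = w a b.
Proof.
move=> aP bP abP; have aa := root_dot_gt0 Psi_root aP.
have ba : b != a.
  apply/eqP => E; have := root_reduced Psi_root aP (c := 2).
  rewrite scaler_nat mulr2n -{2}E => /(_ abP); case=> h; lra.
have bNa : b != - a.
  apply: contraTneq abP => ->; rewrite subrr; exact: root_neq0 Psi_root.
have [i Ei i3] := pairing_cases Psi_root aP bP ba bNa.
have sb : refl a b = b - i%:~R *: a by rewrite /reflection Ei.
have dab : dot a b = i%:~R * dot a a / 2.
  move: Ei; rewrite dot_coroot (dotC dot b a) => <-.
  by field; rewrite gt_eqF.
(* every root of the string has pairing at most 3 in absolute value *)
have bound (k : int) : b + k%:~R *: a \in Psi -> (`|(i + 2 * k)%R| <= 3)%N.
  move=> kP.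
  have nk : b + k%:~R *: a != a.
    apply/eqP => /(canRL (addrK _)) E.
    have Eb : b = (1 - k%:~R) *: a by rewrite scalerBl scale1r -E.
    case: (root_reduced Psi_root aP (c := 1 - k%:~R)); rewrite -?Eb // => h.
      by move: ba; rewrite Eb h scale1r eqxx.
    by move: bNa; rewrite Eb h scaleN1r eqxx.
  have nNk : b + k%:~R *: a != - a.
    apply/eqP => /(canRL (addrK _)) E.
    have Eb : b = (- 1 - k%:~R) *: a by rewrite scalerBl scaleN1r -E.
    case: (root_reduced Psi_root aP (c := - 1 - k%:~R)); rewrite -?Eb // => h.
      by move: ba; rewrite Eb h scale1r eqxx.
    by move: bNa; rewrite Eb h scaleN1r eqxx.
  have [j Ej j3] := pairing_cases Psi_root aP kP nk nNk.
  suff -> : i + 2 * k = j by [].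
  apply/eqP; rewrite -(eqr_int R) -Ej intrD intrM -Ei !dot_coroot dotDl dotZl.
  by apply/eqP; field; rewrite gt_eqF.
have sk (k : int) : refl a (b + k%:~R *: a) = b + (- i - k)%:~R *: a.
  rewrite linearD linearZ /= reflection_self sb intrD !intrN scalerN.
  by rewrite !scalerDl !scaleNr addrA.
have refE (k : int) : (b + k%:~R *: a \in Psi) = (b + (- i - k)%:~R *: a \in Psi).
  by rewrite -sk (root_reflE Psi_root).
have E1 : a + b = b + 1%:~R *: a by rewrite scale1r addrC.
have E2 : a - - (a + b) = b + 2%:~R *: a.
  by rewrite opprK scaler_nat mulr2n addrA addrC.
have Em : (a - b \in Psi) = (b + (-1)%:~R *: a \in Psi).
  by rewrite (root_subC Psi_root) intrN scaleN1r.
have E0 : (b + 0%:~R *: a \in Psi) by rewrite scale0r addr0.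
rewrite /w abP E2 Em (_ : a + - (a + b) = - b); last by rewrite opprD addNKr.
rewrite (root_oppE Psi_root) bP /=.
have dac : dot a (- (a + b)) = - (i%:~R + 2) * dot a a / 2.
  by rewrite dotNr dotDr dab; field.
rewrite dac dab.
have i1 : (`|(i + 2)%R| <= 3)%N by apply: (bound 1); rewrite -E1.
have {i1 i3} : i \in [:: 1; 0; -1; -2; -3].
  by move: i1 i3; clear; rewrite !inE; lia.
have abP' : b + 1%:~R *: a \in Psi by rewrite -E1.
(* the pairing i decides which of a - b and 2 a + b are roots, except that for
   i = -1 the reflection in a only shows that both or none of them are *)
rewrite !inE => /or4P[|||/orP[]] /eqP Ei'; move: bound refE; rewrite Ei' => bound refE.
- rewrite (refE (-1)) (_ : - 1 - -1 = 0 :> int) // E0 /=.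
  have -> : (b + 2%:~R *: a \in Psi) = false by apply/negP => /bound.
  rewrite /= !mul1r ; case: (ltgtP (dot a a / 2) 0) => h; lra.
- rewrite (refE (-1)) (_ : - 0 - -1 = 1 :> int) // abP' /=.
  have -> : (b + 2%:~R *: a \in Psi) = false by apply/negP => /bound.
  by rewrite /= !mul0r eqxx; field.
- rewrite (refE 2) (_ : - -1 - 2 = -1 :> int) //.
  case: (b + (-1)%:~R *: a \in Psi) => /=; last by field.
  by rewrite (_ : - ((-1)%:~R + 2) = (-1)%:~R :> R) //; ring.
- rewrite (refE 2) (_ : - -2 - 2 = 0 :> int) // E0 /=.
  have -> : (b + (-1)%:~R *: a \in Psi) = false by apply/negP => /bound.
  by rewrite /= (_ : - (_ + 2) * _ / 2 = 0) ?eqxx; field.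
- rewrite (refE 2) (_ : - -3 - 2 = 1 :> int) // abP' /=.
  have -> : (b + (-1)%:~R *: a \in Psi) = false by apply/negP => /bound.
  rewrite /= (_ : - ((-3)%:~R + 2) * dot a a / 2 = dot a a / 2); last by field.
  by case: (ltgtP (dot a a / 2) 0) => h; lra.
Qed.


(** With [s] the sign of a root, [X] is twice the sum of the positive roots.
    The inner products in [<X,X>] are differences of triple weights, so that
    [<X,X>] is determined by the sum [A] of the weights multiplied by two of the
    three signs of the triple.  The hypothesis on sums of roots says that the
    three products of two signs in a triple of sum zero add up to -1, whence
    [3 A] is minus the sum of all weights; a second moment computes the latter. *)
Lemma strange_sum (s : V -> R) (kappa : R) :
    {in Psi, forall a, s (- a) = - s a} -> {in Psi, forall a, s a ^+ 2 = 1} ->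
    {in Psi &, forall a b, a + b \in Psi ->
      s a * s b - s a * s (a + b) - s b * s (a + b) = -1} ->
    {in Psi, forall a, \sum_(b <- Psi) dot a b ^+ 2 = kappa * dot a a} ->
  let X := \sum_(a <- Psi) s a *: a in
  dot X X = 2 / 3 * (\sum_(a <- Psi) dot a a + (size Psi)%:R * kappa).
Proof.
move=> sN s2 s3 sk X.
have wN a : a \in Psi -> w a a = 0 /\ w a (- a) = 0.
  move=> aP; rewrite !triple_weight0 //.
    by rewrite subrr (root_neq0 Psi_root).
  apply/negP; rewrite -mulr2n -scaler_nat.
  by case/(root_reduced Psi_root aP) => h; lra.
have string_sum a (G : V -> R) : a \in Psi ->
    \sum_(b <- Psi) w a b * G (- (a + b)) = \sum_(b <- Psi) w a b * G b.
  move=> aP; pose f b := if a + b \in Psi then - (a + b) else b.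
  have fP : {in Psi, forall b, f b \in Psi}.
    by move=> b bP; rewrite /f; case: ifP => // abP; rewrite (root_oppE Psi_root).
  have fK : {in Psi, involutive f}.
    move=> b bP; rewrite {2}/f; case: ifP => abP; last by rewrite /f abP.
    by rewrite /f opprD addNKr (root_oppE Psi_root) bP opprK.
  rewrite -[RHS](sum_root_bij Psi_uniq _ fP fK); apply: eq_big_seq => b bP.
  rewrite /f; case: ifP => abP; last by rewrite triple_weight0 ?abP // !mul0r.
  by rewrite triple_weight_string.
(* A is unchanged when the two signs of a triple are chosen otherwise *)
pose A := \sum_(a <- Psi) \sum_(b <- Psi) w a b * (s a * s b).
pose W := \sum_(a <- Psi) \sum_(b <- Psi) w a b.
have A3 : 3 * A = - W.
  have Ac : A = \sum_(a <- Psi) \sum_(b <- Psi) w a b * (s a * s (- (a + b))).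
    apply: eq_big_seq => a aP.
    by rewrite (string_sum a (fun c => s a * s c)).
  have Ad : A = \sum_(a <- Psi) \sum_(b <- Psi) w a b * (s b * s (- (a + b))).
    rewrite Ac exchange_big /=; apply: eq_big_seq => a aP.
    by apply: eq_big_seq => b bP; rewrite triple_weightC // (addrC b).
  have -> : 3 * A = A + A + A by ring.
  rewrite {1}Ac {1}Ad /A /W -!big_split /= -sumrN; apply: eq_big_seq => a aP.
  rewrite -!big_split /= -sumrN; apply: eq_big_seq => b bP.
  have [abP|abP] := boolP (a + b \in Psi); last first.
    by rewrite triple_weight0 // !mul0r !addr0 oppr0.
  by rewrite -!mulrDr sN // -[RHS]mulrN1 -(s3 a b) //; ring.
(* changing b to - b in one copy of A makes the differences of weights appear *)
have A2 : 2 * A = 2 * \sum_(a <- Psi) dot a a - dot X X.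
  have -> : 2 * A = A + A by ring.
  have {2}-> : A =
      \sum_(a <- Psi) \sum_(b <- Psi) - (w a (- b) * (s a * s b)).
    apply: eq_big_seq => a aP; rewrite -(sum_root_opp Psi_root Psi_uniq).
    by apply: eq_big_seq => b bP; rewrite sN // !mulrN.
  rewrite /X dot_suml mulr_sumr -big_split -sumrB; apply: eq_big_seq => a aP.
  rewrite /= dot_sumr -big_split /= !(sum_root_pm Psi_root Psi_uniq _ aP) opprK.
  have [-> ->] := wN a aP; rewrite sN // !dotE.
  rewrite [in RHS]opprD [RHS]addrA; congr (_ + _).
    have := s2 a aP; rewrite expr2 => sa.
    rewrite !mul0r; have -> : s a * (s a * dot a a) = dot a a.
      by rewrite mulrA sa mul1r.
    by rewrite !(mulrN, mulNr) mulrA sa; ring.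
  rewrite -sumrN big_seq_cond [RHS]big_seq_cond; apply: eq_bigr => b.
  move=> /andP[bP /andP[bNa ba]]; rewrite !dotE -(triple_weightB aP bP ba bNa).
  by ring.
(* for fixed a, the weights are summed by parts along the a-strings *)
have Wk : W = (size Psi)%:R * kappa - 2 * \sum_(a <- Psi) dot a a.
  have -> : (size Psi)%:R * kappa = \sum_(a <- Psi) kappa.
    by rewrite big_const_seq count_predT iter_addr_0 mulr_natl.
  rewrite mulr_sumr -sumrB; apply: eq_big_seq => a aP.
  have aa := root_dot_gt0 Psi_root aP.
  apply: (@mulIf _ (dot a a)); first by rewrite gt_eqF.
  rewrite mulrBl -sk //.
  have D : \sum_(b <- Psi) dot a b ^+ 2 - 2 * dot a a ^+ 2 =
      - 2 * \sum_(b <- Psi) w a b * dot a b.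
    have -> : - 2 * \sum_(b <- Psi) w a b * dot a b =
      \sum_(b <- Psi) (w a (- b) * dot a b - w a b * dot a b).
      rewrite sumrB -[X in _ = X - _](sum_root_opp Psi_root Psi_uniq).
      under [X in _ = X - _]eq_bigr do rewrite opprK dotNr mulrN.
      by rewrite sumrN; ring.
    rewrite !(sum_root_pm Psi_root Psi_uniq _ aP) opprK.
    have [-> ->] := wN a aP; rewrite !dotE.
    rewrite addrC addrA (_ : - _ + _ = 0); last by ring.
    rewrite (_ : _ - _ + _ = 0); last by ring.
    rewrite !add0r big_seq_cond [RHS]big_seq_cond; apply: eq_bigr => b.
    by move=> /andP[bP /andP[bNa ba]]; rewrite -mulrBl triple_weightB.
  have := string_sum a (dot a) aP.
  under eq_bigr do rewrite dotNr dotDr mulrN mulrDr opprD.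
  rewrite big_split !sumrN /= -mulr_suml => E.
  by move: D E; clear; lra.
by move: A3 A2 Wk; clear; lra.
Qed.

End Weights.

(** * Bases, dominant vectors and highest roots *)

Lemma seq_argmax (R : realType) (T : eqType) (s : seq T) (P : pred T) (f : T -> R) :
  (exists2 a, a \in s & P a) ->
  exists a, [/\ a \in s, P a & forall b, b \in s -> P b -> f b <= f a].
Proof.
elim: s => [[a //]|c s IH [a]].
have [/hasP[d ds Pd]|/hasPn nP] := boolP (has P s); last first.
  rewrite inE => /orP[/eqP->|/nP/negP//] Pc; exists c; split=> //.
    exact: mem_head.
  by move=> b; rewrite inE => /orP[/eqP->//|/nP/negP].
have [|m [ms Pm mmax]] := IH; first by exists d.
have [/andP[Pc fc]|nc] := boolP (P c && (f m <= f c)).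
  exists c; split=> //; first exact: mem_head.
  move=> b; rewrite inE => /orP[/eqP->//|bs Pb].
  exact: le_trans (mmax b bs Pb) fc.
exists m; split=> //; first by rewrite inE ms orbT.
move=> b; rewrite inE => /orP[/eqP-> Pc|]; last exact: mmax.
by move: nc; rewrite Pc /= -ltNge => /ltW.
Qed.

(** Signs of real coordinates, unlike their integrality, pass at once to the
    coroots, whose coordinates are those of the roots multiplied by positive
    factors. *)
Record sign_base (R : realType) (V : vectType R) (Psi : seq V) (n : nat)
    (E : n.-tuple V) : Prop := SignBase {
  sign_base_sub : {subset E <= Psi};
  sign_base_basis : basis_of fullv E;
  sign_base_sign : forall a, a \in Psi ->
    (forall i, 0 <= coord E i a) \/ (forall i, coord E i a <= 0)
}.

Section Base.
Variables (R : realType) (V : vectType R) (dot : {dot V for idfun}).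
Variables (Psi : seq V) (n : nat) (E : n.-tuple V).
Hypotheses (Psi_root : root_system dot Psi) (E_base : sign_base Psi E).
Implicit Types (a b x y z : V).

Local Notation refl := (reflection dot).
Local Notation e i := (tnth E i).

Let bE : basis_of fullv E := sign_base_basis E_base.

Definition pos_root a := [forall i, 0 <= coord E i a].

Lemma pos_rootP a : reflect (forall i, 0 <= coord E i a) (pos_root a).
Proof. exact: forallP. Qed.

Lemma simple_root i : e i \in Psi.
Proof. by apply: (sign_base_sub E_base); apply: mem_tnth. Qed.

Lemma coord_sum x : x = \sum_i coord E i x *: e i.
Proof.
rewrite {1}(coord_basis bE (memvf x)).
by apply: eq_bigr => i _; rewrite (tnth_nth 0).
Qed.

Lemma coord_simple i j : coord E i (e j) = (i == j)%:R.
Proof. by rewrite (tnth_nth 0) coord_free ?(basis_free bE) // eq_sym. Qed.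

Lemma dot_coord x y : dot x y = \sum_i coord E i x * dot (e i) y.
Proof.
by rewrite {1}(coord_sum x) dot_suml; apply: eq_bigr => i _; rewrite dotZl.
Qed.

Lemma heightD x y : height E (x + y) = height E x + height E y.
Proof. by rewrite /height -big_split; apply: eq_bigr => i _; rewrite linearD. Qed.

Lemma heightZ c x : height E (c *: x) = c * height E x.
Proof. by rewrite /height mulr_sumr; apply: eq_bigr => i _; rewrite linearZ. Qed.

Lemma heightN x : height E (- x) = - height E x.
Proof. by rewrite -scaleN1r heightZ mulN1r. Qed.

Lemma height_simple i : height E (e i) = 1.
Proof.
rewrite /height (bigD1 i) //= coord_simple eqxx big1 ?addr0 // => j ji.
by rewrite coord_simple (negbTE ji).
Qed.

Lemma height_reflection i x :
  height E (refl (e i) x) = height E x - dot x (coroot dot (e i)).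
Proof. by rewrite /reflection heightD heightN heightZ height_simple mulr1. Qed.

Lemma coord_reflection i j x :
  coord E j (refl (e i) x) = coord E j x - dot x (coroot dot (e i)) * (j == i)%:R.
Proof. by rewrite /reflection linearB linearZ /= coord_simple. Qed.

Lemma coord_eq0P x : (forall i, coord E i x = 0) -> x = 0.
Proof. by move=> x0; rewrite (coord_sum x) big1 // => i _; rewrite x0 scale0r. Qed.

Lemma root_coord_neq0 a : a \in Psi -> exists i, coord E i a != 0.
Proof.
move=> aP; apply/existsP; apply: contraNT (root_neq0 Psi_root).
rewrite negb_exists => /forallP a0; suff <- : a = 0 by [].
by apply: coord_eq0P => i; apply/eqP; move: (a0 i); rewrite negbK.
Qed.

Lemma pos_root_coord a i : a \in Psi -> 0 < coord E i a -> pos_root a.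
Proof.
move=> aP ai; apply/pos_rootP; case: (sign_base_sign E_base aP) => // /(_ i).
by rewrite leNgt ai.
Qed.

Lemma neg_root_coord a i : a \in Psi -> coord E i a < 0 -> pos_root (- a).
Proof.
move=> aP ai; apply: (@pos_root_coord _ i).
  exact: root_opp Psi_root _ aP.
by rewrite linearN oppr_gt0.
Qed.

Lemma pos_rootN a : a \in Psi -> pos_root (- a) = ~~ pos_root a.
Proof.
move=> aP; have [i] := root_coord_neq0 aP; case: ltgtP => // ai _.
  rewrite (neg_root_coord aP ai); apply/esym/pos_rootP => /(_ i).
  by rewrite leNgt ai.
rewrite (pos_root_coord aP ai); apply/pos_rootP => /(_ i).
by rewrite linearN oppr_ge0 leNgt ai.
Qed.

Lemma pos_root_simple i : pos_root (e i).
Proof.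
by apply/pos_rootP => j; rewrite coord_simple; case: eqP.
Qed.

Lemma height_gt0 a : a \in Psi -> pos_root a -> 0 < height E a.
Proof.
move=> aP /pos_rootP ap; have [i ai] := root_coord_neq0 aP.
rewrite /height (bigD1 i) //= ltr_pwDl ?sumr_ge0 //.
by rewrite lt_def ai ap.
Qed.

Lemma simple_obtuse i j : i != j -> dot (e i) (e j) <= 0.
Proof.
move=> ij; rewrite leNgt; apply/negP => d.
have nij : e i != e j.
  apply: contraNneq ij => /(congr1 (coord E i)); rewrite !coord_simple eqxx.
  by case: eqP => // _ /eqP; rewrite oner_eq0.
have := sub_root Psi_root (simple_root i) (simple_root j) d nij.
case/(sign_base_sign E_base) => [/(_ j)|/(_ i)];
  rewrite linearB /= !coord_simple eqxx 1?(eq_sym j) (negbTE ij) /= => h; lra.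
Qed.

(** A reflection in a simple root changes a single coordinate, so that it can
    make negative only the roots proportional to this simple root. *)
Lemma pos_root_reflection i a : a \in Psi -> pos_root a -> a != e i ->
  pos_root (refl (e i) a).
Proof.
move=> aP ap aei; have aP' := root_reflection Psi_root (simple_root i) aP.
suff [j ji aj] : exists2 j, j != i & coord E j a != 0.
  apply: (@pos_root_coord _ j) => //; rewrite coord_reflection (negbTE ji).
  by rewrite mulr0 subr0 lt_def aj; move/pos_rootP: ap => ->.
apply/exists_inP; apply: contraR aei; rewrite negb_exists_in => /forall_inP a0.
have Ea : a = coord E i a *: e i.
  rewrite {1}(coord_sum a) (bigD1 i) //= big1 ?addr0 // => j ji.
  by have := a0 j ji; rewrite negbK => /eqP ->; rewrite scale0r.
have [] := root_reduced Psi_root (simple_root i) (c := coord E i a).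
- by rewrite -Ea.
- by move=> h; rewrite Ea h scale1r.
by move=> h; have /pos_rootP/(_ i) := ap; rewrite h ler0N1.
Qed.

Section Dominant.
Hypothesis Psi_irr : irreducible_roots dot Psi.

Definition dominant x := forall i, 0 <= dot x (e i).

Lemma dominant_dot_ge0 x a : dominant x -> pos_root a -> 0 <= dot x a.
Proof.
move=> xd /pos_rootP ap; rewrite dotC dot_coord sumr_ge0 // => i _.
by rewrite mulr_ge0 // dotC.
Qed.

Lemma dominant_root_pos a : a \in Psi -> dominant a -> pos_root a.
Proof.
move=> aP ad; case: (boolP (pos_root a)) => // /negbTE an.
have := dominant_dot_ge0 ad (a := - a); rewrite pos_rootN // an => /(_ isT).
by rewrite dotNr oppr_ge0 leNgt (root_dot_gt0 Psi_root).
Qed.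

(** A simple reflection subtracts from the height the pairing with a simple
    coroot, so it would raise the height at a root that is not dominant. *)
Lemma max_height_dominant (P : pred V) b : b \in Psi -> P b ->
  (forall c, c \in Psi -> P c -> height E c <= height E b) ->
  (forall i, dot b (e i) < 0 -> P (refl (e i) b)) -> dominant b.
Proof.
move=> bP Pb bmax Prefl i; rewrite leNgt; apply/negP => bi.
have := bmax _ (root_reflection Psi_root (simple_root i) bP) (Prefl i bi).
rewrite height_reflection dot_coroot => h.
have ei := root_dot_gt0 Psi_root (simple_root i).
have : 2 * dot b (e i) / dot (e i) (e i) < 0.
  by rewrite pmulr_llt0 ?invr_gt0 // pmulr_rlt0.
by move: h; lra.
Qed.

(** If the support [J] of a dominant root [b] were proper, [J] would be
    orthogonal to its complement, since the base is obtuse; the roots supported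
    in [J] and those supported outside [J] would then exhaust the root system
    and contradict irreducibility.  They exhaust it because, for a positive root
    [a] of minimal height among those with mixed support, some simple reflection
    with index in [J] must remove its whole part in [J]; this part is then a
    multiple [k e_i] such that [k = <a,e_i^v> = 2 k]. *)
Lemma dominant_full_support b : b \in Psi -> dominant b ->
  forall i, 0 < coord E i b.
Proof.
move=> bP bd i0; have /pos_rootP b0 := dominant_root_pos bP bd.
rewrite lt_def b0 andbT; apply/negP => bi0.
pose J i := coord E i b != 0.
have orthJ i j : J i -> ~~ J j -> dot (e i) (e j) = 0.
  move=> Ji Jj; have := bd j; rewrite dot_coord.
  have le0 k : coord E k b * dot (e k) (e j) <= 0.
    have [->|kj] := eqVneq k j; last by rewrite mulr_ge0_le0 ?simple_obtuse.
    by move: Jj; rewrite negbK => /eqP ->; rewrite mul0r.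
  rewrite (bigD1 i) //= => h; have := le0 i.
  have : \sum_(k < n | k != i) coord E k b * dot (e k) (e j) <= 0.
    by apply: sumr_le0.
  move=> h1 h2; have /eqP : coord E i b * dot (e i) (e j) = 0 by lra.
  by rewrite mulf_eq0 (negbTE Ji) => /eqP.
pose bad a := [&& pos_root a, [exists i, J i && (coord E i a != 0)] &
                              [exists i, ~~ J i && (coord E i a != 0)]].
have no_bad a : a \in Psi -> ~~ bad a.
  move=> aP; apply/negP => bada.
  have [|{}a [{}aP {}bada amin]] :=
      @seq_argmax R V Psi bad (fun x => - height E x); first by exists a.
  case/and3P: (bada) => /pos_rootP a0 /exists_inP[i1 Ji1 ai1] /exists_inP[j Jj aj].
  pose aJ := \sum_(i | J i) coord E i a *: e i.
  have aJE i : J i -> dot aJ (e i) = dot a (e i).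
    move=> Ji; rewrite [in RHS]dot_coord /aJ dot_suml [RHS](bigID J) /=.
    rewrite [X in _ + X]big1 ?addr0; last first.
      by move=> k Jk; rewrite dotC orthJ // mulr0.
    by apply: eq_bigr => k _; rewrite dotZl.
  have coordJ i : coord E i aJ = if J i then coord E i a else 0.
    rewrite /aJ linear_sum /=.
    under eq_bigr do rewrite linearZ /= coord_simple.
    case: ifP => Ji.
      rewrite (bigD1 i) //= eqxx mulr1 big1 ?addr0 // => k /andP[_ ki].
      by rewrite eq_sym (negbTE ki) mulr0.
    rewrite big1 // => k Jk; have [E1|] := eqVneq i k; last by rewrite mulr0.
    by move: Jk; rewrite -E1 Ji.
  have aJ0 : 0 < dot aJ aJ.
    apply: dot_gt0; apply: contraNneq ai1 => /(congr1 (coord E i1)).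
    by rewrite coordJ Ji1 linear0 => ->.
  have [i Ji di] : exists2 i, J i & 0 < dot a (e i).
    apply/exists_inP; apply: contraLR aJ0; rewrite negb_exists_in.
    move=> /forall_inP h; rewrite -leNgt {2}/aJ dot_sumr.
    apply: sumr_le0 => k Jk; rewrite dotZr aJE // mulr_ge0_le0 //.
    by rewrite leNgt h.
  have ei := root_dot_gt0 Psi_root (simple_root i).
  pose k := dot a (coroot dot (e i)).
  have k0 : 0 < k by rewrite /k dot_coroot divr_gt0 // mulr_gt0.
  pose a' := refl (e i) a.
  have a'P : a' \in Psi by exact: (root_reflection Psi_root (simple_root i) aP).
  have ij : j != i by apply: contraNneq Jj => ->.
  have a'j : coord E j a' = coord E j a.
    by rewrite coord_reflection (negbTE ij) mulr0 subr0.
  have a'pos : pos_root a'.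
    by apply: (@pos_root_coord _ j) => //; rewrite a'j lt_def aj a0.
  have : ~~ bad a'.
    apply/negP => /(amin _ a'P); rewrite lerN2 height_reflection -/k.
    by move: k0; lra.
  rewrite /bad a'pos /= => /nandP[]; last first.
    by rewrite negb_exists => /forallP/(_ j); rewrite Jj a'j aj.
  rewrite negb_exists_in => /forall_inP a'J.
  have coordk l : J l -> coord E l a = k * (l == i)%:R.
    move=> /a'J; rewrite negbK coord_reflection -/k subr_eq0; exact/eqP.
  have : dot a (e i) = k * dot (e i) (e i).
    rewrite -aJE // /aJ dot_suml (bigD1 i) //= dotZl (coordk i) // eqxx mulr1.
    rewrite big1 ?addr0 // => l /andP[Jl li].
    by rewrite dotZl coordk // (negbTE li) mulr0 mul0r.
  have : dot a (e i) = k * dot (e i) (e i) / 2.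
    by rewrite /k dot_coroot; field; rewrite gt_eqF.
  move=> -> h; have : 0 < k * dot (e i) (e i) by rewrite mulr_gt0.
  by move: h; lra.
have no_bad' a : a \in Psi ->
    (forall i, J i -> coord E i a = 0) \/ (forall i, ~~ J i -> coord E i a = 0).
  move=> aP; have : ~~ bad a && ~~ bad (- a).
    by rewrite !no_bad // (root_oppE Psi_root).
  have NE (Q : pred 'I_n) : [exists i, Q i && (coord E i (- a) != 0)]
       = [exists i, Q i && (coord E i a != 0)].
    by apply: eq_existsb => i; rewrite linearN oppr_eq0.
  rewrite /bad NE (NE (fun i => ~~ J i)) pos_rootN //.
  case: (pos_root a); rewrite /= ?andbT => /nandP[];
    rewrite negb_exists_in => /forall_inP h;
    by [left=> i /h /negPn/eqP | right=> i /h /negPn/eqP].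
have [||a [c [aP Pa cP Pc]]] :=
    Psi_irr.2 (fun a => [forall (i | ~~ J i), coord E i a == 0]).
- by exists b => //; apply/forall_inP => i; rewrite negbK.
- exists (e i0); first exact: simple_root.
  rewrite negb_forall_in; apply/exists_inP; exists i0; rewrite ?negbK //.
  by rewrite coord_simple eqxx oner_eq0.
apply/negP; rewrite negbK; apply/eqP.
have cJ : forall i, J i -> coord E i c = 0.
  by case: (no_bad' c cP) => // h; case/negP: Pc; apply/forall_inP => i /h ->.
rewrite dot_coord big1 // => i _; rewrite dotC dot_coord.
have [Ji|Ji] := boolP (J i); last first.
  by move/forall_inP: Pa => /(_ i Ji) /eqP ->; rewrite mul0r.
rewrite big1 ?mulr0 // => j _; have [/cJ ->|Jj] := boolP (J j); rewrite ?mul0r //.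
by rewrite dotC orthJ // mulr0.
Qed.

Variable eta : V.
Hypothesis eta_max : highest_root E Psi eta.

Lemma highest_dominant : dominant eta.
Proof.
apply: (@max_height_dominant xpredT) => // [|c cP _]; first exact: eta_max.1.
exact: eta_max.2.
Qed.

(** The root maximizing first [<y,->] and then the height is dominant; two
    dominant roots have positive inner product, hence, if distinct, their
    difference is a root, and this contradicts one of the maximalities. *)
Lemma highest_root_max y a : dominant y -> a \in Psi -> dot y a <= dot y eta.
Proof.
move=> yd aP; have [etaP eta_ht] := eta_max.
have [|m [mP _ mmax]] := @seq_argmax R V Psi xpredT (dot y); first by exists a.
have [|b [bP /eqP yb bmax]] :=
  @seq_argmax R V Psi (fun x => dot y x == dot y m) (height E); first by exists m.
have bd : dominant b.
  apply: (max_height_dominant bP _ bmax); first exact/eqP.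
  move=> i bi; have ei := root_dot_gt0 Psi_root (simple_root i).
  rewrite eq_le mmax ?(root_reflection Psi_root) ?simple_root //=.
  rewrite -yb /reflection dotDr dotNr dotZr lerDl oppr_ge0 dot_coroot.
  by rewrite mulr_le0_ge0 // pmulr_lle0 ?invr_gt0 // pmulr_rle0 // ltW.
have etap := dominant_root_pos etaP highest_dominant.
have bfull := dominant_full_support bP bd.
have b_eta : 0 < dot eta b.
  rewrite lt_def (dominant_dot_ge0 highest_dominant (dominant_root_pos bP bd)).
  rewrite andbT; apply: contraTneq (root_dot_gt0 Psi_root etaP) => eb.
  suff -> : eta = 0 by rewrite dot0l ltxx.
  apply: (dot_basis_eq (dot := dot) bE) => i; rewrite dot0l.
  move/eqP: eb; rewrite dotC dot_coord psumr_eq0 => [/allP/(_ i)|j _].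
    rewrite mem_index_enum => /(_ isT); rewrite mulf_eq0 gt_eqF //= => /eqP.
    by rewrite dotC.
  by rewrite mulr_ge0 ?(ltW (bfull j)) // dotC highest_dominant.
have [->|neq] := eqVneq eta b; first by rewrite yb mmax.
have gP := sub_root Psi_root etaP bP b_eta neq.
have [gp|gn] := boolP (pos_root (eta - b)).
  have := height_gt0 gP gp; rewrite heightD heightN.
  suff /(bmax _ etaP) : dot y eta == dot y m by move=> h1 h2; lra.
  rewrite eq_le mmax //= -yb -subr_ge0 -dotNr -dotDr.
  exact: dominant_dot_ge0.
have := height_gt0 (a := - (eta - b)); rewrite (root_oppE Psi_root) pos_rootN //.
by move=> /(_ gP gn); rewrite heightN heightD heightN; have := eta_ht b bP; lra.
Qed.

(** A root of maximal height among those of a given norm is dominant, so its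
    inner product with the highest root bounds its own squared norm, and is in
    turn bounded by that of the highest root. *)
Lemma highest_root_norm a : a \in Psi -> dot a a <= dot eta eta.
Proof.
move=> aP; have [|b [bP /eqP ba bmax]] :=
    @seq_argmax R V Psi (fun x => dot x x == dot a a) (height E).
  by exists a.
have bd : dominant b.
  apply: (max_height_dominant bP _ bmax) => [|i _]; first exact/eqP.
  by rewrite dot_reflection ba.
rewrite -ba; apply: (le_trans (highest_root_max bd bP)).
by rewrite dotC; apply: highest_root_max => //; apply: highest_dominant.
Qed.

(** As [eta] is at least as long as [a], the pairing of [a] with the coroot of
    [eta] is the smaller of two integers of product less than 4. *)
Lemma highest_root_pairing a : a \in Psi -> pos_root a -> a != eta ->
  dot a (coroot dot eta) = 0 \/ dot a (coroot dot eta) = 1.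
Proof.
move=> aP ap ae; have [etaP _] := eta_max.
have aa := root_dot_gt0 Psi_root aP; have ee := root_dot_gt0 Psi_root etaP.
have m0 : 0 <= dot a (coroot dot eta).
  rewrite dot_coroot dotC divr_ge0 ?(ltW ee) // mulr_ge0 //.
  exact: dominant_dot_ge0 highest_dominant ap.
have aNe : a != - eta.
  apply: contraTneq ap => ->; rewrite pos_rootN // negbK.
  exact: dominant_root_pos etaP highest_dominant.
have lt4 := pairing_lt4 Psi_root etaP aP ae aNe.
have le : dot a (coroot dot eta) <= dot eta (coroot dot a).
  rewrite !dot_coroot (dotC dot eta a) ler_wpM2l ?lef_pV2 ?posrE //.
    rewrite mulr_ge0 // dotC.
    exact: dominant_dot_ge0 highest_dominant ap.
  exact: highest_root_norm.
have /intrP[i Ei] := root_crystallographic Psi_root etaP aP.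
move: m0 le lt4; rewrite Ei ler0z; set t := dot eta _ => i0 le lt4.
have lt : i%:~R * i%:~R < (4 : R).
  by apply: le_lt_trans lt4; rewrite ler_wpM2r ?ler0z.
have : i = 0 \/ i = 1.
  by move: i0 lt; rewrite -intrM -[4]/(4%:~R) ltr_int; clear; nia.
by case=> ->; [left|right].
Qed.

End Dominant.
End Base.

(** * Invariant forms and signs of roots *)

Section InvariantForm.
Variables (R : realType) (V : vectType R) (dot : {dot V for idfun}).
Variable Psi : seq V.
Hypotheses (Psi_root : root_system dot Psi) (Psi_uniq : uniq Psi).
Hypothesis Psi_irr : irreducible_roots dot Psi.
Implicit Types (a b x y z : V).

Local Notation refl := (reflection dot).

Lemma root_dot_eq x y : {in Psi, forall a, dot x a = dot y a} -> x = y.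
Proof.
move=> Exy; apply/eqP; rewrite -subr_eq0 -(dot_eq0 dot).
have : x - y \in <<in_tuple Psi>>%VS by rewrite (root_span Psi_root) memvf.
move/coord_span => {2}->; rewrite dot_sumr big1 // => i _.
by rewrite dotZr dotDl dotNl Exy ?subrr ?mulr0 // mem_nth.
Qed.

(** The operator [x |-> \sum_a f a * <x,a> a] commutes with the reflections.
    Hence it maps each root [b] to a multiple of [b], and being symmetric it has
    the same eigenvalue on any two roots that are not orthogonal. *)
Lemma invariant_form (f : V -> R) :
    {in Psi &, forall a b, f (refl a b) = f b} ->
  exists k, forall x y,
    \sum_(a <- Psi) f a * (dot x a * dot y a) = k * dot x y.
Proof.
move=> frefl; pose T x := \sum_(a <- Psi) (f a * dot x a) *: a.
have TE x y : \sum_(a <- Psi) f a * (dot x a * dot y a) = dot (T x) y.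
  rewrite dot_suml; apply: eq_bigr => a _.
  by rewrite dotZl (dotC dot y a) mulrA.
have TC x y : dot (T x) y = dot x (T y).
  by rewrite (dotC dot x) -!TE; apply: eq_bigr => a _; rewrite [dot y a * _]mulrC.
have Trefl b x : b \in Psi -> T (refl b x) = refl b (T x).
  move=> bP; apply: root_dot_eq => c _.
  rewrite dot_reflection_adj -!TE -[RHS](sum_root_refl Psi_root Psi_uniq _ bP).
  apply: eq_big_seq => a aP.
  by rewrite frefl // dot_reflection -dot_reflection_adj.
pose k b := dot (T b) (coroot dot b) / 2.
have Tb b : b \in Psi -> T b = k b *: b.
  move=> bP; have TN x : T (- x) = - T x.
    by rewrite /T -sumrN; apply: eq_bigr => a _; rewrite dotNl mulrN scaleNr.
  have := Trefl b b bP; rewrite reflection_self TN /reflection => E.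
  have {}E : 2 *: T b = (2 * k b) *: b.
    rewrite scaler_nat mulr2n -{1}[T b]opprK E opprB.
    by rewrite subrK mulrC divfK // pnatr_eq0.
  have n2 : (2 : R) != 0 by rewrite pnatr_eq0.
  by apply: (scalerI n2); rewrite E scalerA.
have kC a b : a \in Psi -> b \in Psi -> dot a b != 0 -> k a = k b.
  move=> aP bP ab; apply: (mulIf ab).
  by have := TC a b; rewrite !Tb // dotZl dotZr.
have [[a0 a0P] irr] := Psi_irr; exists (k a0) => x y.
have kE b : b \in Psi -> k b = k a0.
  move=> bP; apply/eqP; apply/negPn/negP => kb.
  have [||a [c [aP /eqP ka cP kc ac]]] := irr (fun b => k b == k a0).
  - by exists a0.
  - by exists b.
  by case/negP: kc; rewrite -ka (kC a c).
rewrite TE -dotZl; congr (dot _ y); apply: root_dot_eq => b bP.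
by rewrite TC Tb // dotZr dotZl kE.
Qed.

End InvariantForm.

Section Signs.
Variables (R : realType) (V : vectType R) (dot : {dot V for idfun}).
Variables (Psi : seq V) (n : nat) (E : n.-tuple V).
Hypotheses (Psi_root : root_system dot Psi) (Psi_uniq : uniq Psi).
Hypothesis E_base : sign_base Psi E.
Implicit Types (a b x y z : V).

Local Notation refl := (reflection dot).
Local Notation e i := (tnth E i).

Definition root_sign a : R := if pos_root E a then 1 else -1.

Local Notation sg := root_sign.

Lemma root_signN a : a \in Psi -> sg (- a) = - sg a.
Proof.
move=> aP; rewrite /sg (pos_rootN Psi_root E_base aP).
by case: pos_root; rewrite ?opprK.
Qed.

Lemma root_sign_sqr a : sg a ^+ 2 = 1.
Proof. by rewrite /sg; case: ifP => _; rewrite ?expr1n ?sqrrN ?expr1n. Qed.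

Lemma root_sign_add a b : a \in Psi -> b \in Psi -> a + b \in Psi ->
  sg a * sg b - sg a * sg (a + b) - sg b * sg (a + b) = -1.
Proof.
move=> aP bP abP; rewrite /sg.
have posD x y : pos_root E x -> pos_root E y -> pos_root E (x + y).
  move=> /pos_rootP xp /pos_rootP yp; apply/pos_rootP => i.
  by rewrite linearD; apply: addr_ge0; [apply: xp|apply: yp].
case: (boolP (pos_root E a)) => ap; case: (boolP (pos_root E b)) => bp.
- by rewrite posD //; ring.
- by case: pos_root; ring.
- by case: pos_root; ring.
rewrite ifN; first by ring.
rewrite -(pos_rootN Psi_root E_base abP) opprD posD //.
  by rewrite (pos_rootN Psi_root E_base aP).
by rewrite (pos_rootN Psi_root E_base bP).
Qed.

(** The sum is twice the sum of the positive coroots.  The reflection in a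
    simple root permutes the other positive roots, hence subtracts from the sum
    four times the simple coroot. *)
Lemma sum_sign_coroot rho : (forall i, dot rho (e i) = 1) ->
  \sum_(a <- Psi) sg a *: coroot dot a = 4 *: rho.
Proof.
move=> rho1; set X := \sum_(a <- Psi) _.
apply: (dot_basis_eq (dot := dot) (sign_base_basis E_base)) => i.
have eP := simple_root E_base i; have ei := root_dot_gt0 Psi_root eP.
have eNP := root_opp Psi_root eP.
have sum_pm F : \sum_(a <- Psi) F a * dot (coroot dot a) (e i) = 
  F (e i) * dot (coroot dot (e i)) (e i) - F (- e i) * dot (coroot dot (e i)) (e i)
  + \sum_(b <- Psi | (b != - e i) && (b != e i)) F b * dot (coroot dot b) (e i).
  rewrite (sum_root_pm Psi_root Psi_uniq _ eP) corootN dotNl.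
  by rewrite mulrN.
have XE F : dot (\sum_(a <- Psi) F a *: coroot dot a) (e i) =
    \sum_(a <- Psi) F a * dot (coroot dot a) (e i).
  by rewrite dot_suml; apply: eq_bigr => a _; rewrite dotZl.
have flip : dot X (e i) =
    - \sum_(a <- Psi) sg (refl (e i) a) * dot (coroot dot a) (e i).
  rewrite -(sum_root_refl Psi_root Psi_uniq _ eP) /X XE -sumrN.
  apply: eq_big_seq => a aP.
  rewrite reflectionK coroot_reflection -mulrN dot_reflection_adj.
  by rewrite reflection_self dotNr opprK.
have e1 : sg (e i) = 1 by rewrite /sg (pos_root_simple E_base).
have e2 : dot (coroot dot (e i)) (e i) = 2.
  by rewrite dotE; field; rewrite gt_eqF.
move: flip; rewrite sum_pm linearN /= !reflection_self opprK !root_signN // e1 e2.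
have := XE sg; rewrite -/X sum_pm root_signN // e1 e2.
have -> : \sum_(b <- Psi | (b != - e i) && (b != e i))
      sg (refl (e i) b) * dot (coroot dot b) (e i) =
    \sum_(b <- Psi | (b != - e i) && (b != e i)) sg b * dot (coroot dot b) (e i).
  rewrite big_seq_cond [RHS]big_seq_cond; apply: eq_bigr => b.
  move=> /andP[bP /andP[bN bE]]; congr (_ * _); rewrite /sg.
  have [bp|bn] := boolP (pos_root E b).
    by rewrite (pos_root_reflection Psi_root E_base).
  have bNp : pos_root E (- b) by rewrite (pos_rootN Psi_root E_base).
  have := pos_root_reflection (i := i) Psi_root E_base (root_opp Psi_root bP) bNp.
  rewrite eqr_oppLR bN linearN /= => /(_ isT).
  rewrite (pos_rootN Psi_root E_base) ?(root_reflection Psi_root) //.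
  by move/negbTE ->.
by move=> h1 h2; rewrite dotZl rho1; lra.
Qed.

Lemma height_dot rho x : (forall i, dot rho (e i) = 1) -> height E x = dot rho x.
Proof.
move=> rho1; rewrite dotC (dot_coord dot E_base); apply: eq_bigr => i _.
by rewrite dotC rho1 mulr1.
Qed.

(** A positive root other than the highest root [eta] pairs with its coroot to
    0 or 1, whence weighting by this pairing amounts to weighting by the sign,
    up to the terms of [eta] and [- eta]. *)
Lemma highest_root_sum eta (F : V -> R) :
    irreducible_roots dot Psi -> highest_root E Psi eta ->
    (forall a, F (- a) = - F a) -> (forall a, dot a eta = 0 -> F a = 0) ->
  \sum_(a <- Psi) dot a (coroot dot eta) * F a =
  \sum_(a <- Psi) sg a * F a + 2 * F eta.
Proof.
move=> irr eta_max FN F0; have etaP := eta_max.1.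
have ee := root_dot_gt0 Psi_root etaP.
rewrite !(sum_root_pm Psi_root Psi_uniq _ etaP) root_signN // !FN dotNl.
have -> : dot eta (coroot dot eta) = 2.
  by rewrite dotE; field; rewrite gt_eqF.
have -> : sg eta = 1.
  by rewrite /sg (dominant_root_pos Psi_root E_base etaP) //;
     apply: (highest_dominant Psi_root E_base eta_max).
have pairing a : a \in Psi -> pos_root E a -> a != eta ->
    dot a (coroot dot eta) * F a = F a.
  move=> aP ap ae.
  case: (highest_root_pairing Psi_root E_base irr eta_max aP ap ae) => h.
    rewrite h mul0r F0 //; move: h; rewrite dot_coroot => /eqP.
    by rewrite mulf_eq0 invr_eq0 (gt_eqF ee) mulf_eq0 pnatr_eq0 /= orbF => /eqP.
  by rewrite h mul1r.
set S := \sum_(b <- Psi | _) _; set S' := \sum_(b <- Psi | _) _.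
suff -> : S = S' by ring.
rewrite /S /S' big_seq_cond [RHS]big_seq_cond; apply: eq_bigr => a.
move=> /andP[aP /andP[aN ae]]; rewrite /sg.
have [ap|an] := boolP (pos_root E a); first by rewrite pairing // mul1r.
have := pairing (- a); rewrite (root_oppE Psi_root) (pos_rootN Psi_root) //.
by rewrite eqr_oppLR FN dotNl mulrNN mulN1r; apply.
Qed.

(** Both sides are the trace of the form, computed on a pair of dual bases. *)
Lemma form_trace (omega : n.-tuple V) (f : V -> R) (k : R) :
    (forall i j, dot (tnth omega i) (e j) = (i == j)%:R) ->
    (forall x y, \sum_(a <- Psi) f a * (dot x a * dot y a) = k * dot x y) ->
  \sum_(a <- Psi) f a * dot a a = n%:R * k.
Proof.
move=> dual form.
have coordE i a : dot (tnth omega i) a = coord E i a.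
  rewrite dotC (dot_coord dot E_base) (bigD1 i) //= dotC dual eqxx mulr1.
  rewrite big1 ?addr0 // => j ji.
  by rewrite dotC dual eq_sym (negbTE ji) mulr0.
transitivity (\sum_(i < n) \sum_(a <- Psi)
    f a * (dot (tnth omega i) a * dot (e i) a)).
  rewrite exchange_big /=; apply: eq_bigr => a _.
  rewrite (dot_coord dot E_base) mulr_sumr.
  by apply: eq_bigr => i _; rewrite coordE.
under eq_bigr do rewrite form dual eqxx mulr1.
by rewrite sumr_const card_ord mulr_natl.
Qed.

End Signs.

(** * The dual root system and the strange formula *)

Section DualSystem.
Variables (R : realType) (V : vectType R) (dot : {dot V for idfun}).
Variables (Phi : seq V) (n : nat) (Delta : n.-tuple V).
Hypotheses (Phi_root : root_system dot Phi) (Phi_uniq : uniq Phi).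
Hypothesis Phi_irr : irreducible_roots dot Phi.
Hypothesis Delta_base : sign_base Phi Delta.
Implicit Types (a b x y z : V).

Local Notation refl := (reflection dot).
Local Notation cr := (coroot dot).
Local Notation e i := (tnth Delta i).
Local Notation cDelta := (map_tuple cr Delta).

Lemma mem_coroots a : (cr a \in coroots dot Phi) = (a \in Phi).
Proof. exact/mem_map/inv_inj/corootK. Qed.

Lemma coroots_uniq : uniq (coroots dot Phi).
Proof. by rewrite map_inj_uniq //; apply/inv_inj/corootK. Qed.

Lemma coroots_span (s : seq V) : (<<s>> <= <<coroots dot s>>)%VS.
Proof.
apply/span_subvP => a aP; rewrite -[a](corootK dot).
by rewrite memvZ // memv_span // map_f.
Qed.

Lemma coroots_root_system : root_system dot (coroots dot Phi).
Proof.
split.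
- apply/negP => /mapP[a aP /esym/eqP]; rewrite coroot_eq0 => /eqP a0.
  by case/negP: (root_neq0 Phi_root); rewrite -a0.
- by apply/eqP; rewrite eqEsubv subvf -(root_span Phi_root) coroots_span.
- move=> _ _ /mapP[a aP ->] /mapP[b bP ->].
  rewrite reflection_coroot -coroot_reflection mem_coroots.
  exact: (root_reflection Phi_root).
- move=> _ _ /mapP[a aP ->] /mapP[b bP ->]; rewrite corootK dotC.
  exact: (root_crystallographic Phi_root).
move=> _ c /mapP[a aP ->] /mapP[b bP E].
have aa := root_dot_gt0 Phi_root aP.
have c0 : c != 0.
  apply: contraTneq (root_nz Phi_root bP) => c0.
  by rewrite -(coroot_eq0 dot) -E c0 scale0r eqxx.
have {E} Eb : b = c^-1 *: a.
  rewrite -[b](corootK dot) -E /coroot !dotE !scalerA; congr (_ *: _).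
  by field; rewrite c0 gt_eqF.
have [|h|h] := root_reduced Phi_root aP (c := c^-1); first by rewrite -Eb.
  by left; rewrite -[c]invrK h invr1.
by right; rewrite -[c]invrK h invrN1.
Qed.

Lemma coroots_irreducible : irreducible_roots dot (coroots dot Phi).
Proof.
have [[a aP] irr] := Phi_irr; split; first by exists (cr a); rewrite mem_coroots.
move=> P [_ /mapP[b bP ->] Pb] [_ /mapP[c cP ->] Pc].
have [||x [y [xP Px yP Py xy]]] := irr (fun a => P (cr a)).
- by exists b.
- by exists c.
exists (cr x), (cr y); split; rewrite ?mem_coroots //.
have xx := root_dot_gt0 Phi_root xP; have yy := root_dot_gt0 Phi_root yP.
by rewrite !dotZl !dotZr !mulf_eq0 !invr_eq0 !pnatr_eq0 (gt_eqF xx) (gt_eqF yy).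
Qed.

Lemma coroots_basis : basis_of fullv cDelta.
Proof.
have bD := sign_base_basis Delta_base.
rewrite basisEdim -(span_basis bD) coroots_span /= size_map.
by rewrite (span_basis bD) (size_basis bD) size_tuple.
Qed.

Lemma coord_coroot i a : a \in Phi ->
  coord cDelta i (cr a) = coord Delta i a * (dot (e i) (e i) / dot a a).
Proof.
move=> aP; have aa := root_dot_gt0 Phi_root aP.
have coordE j : coord cDelta i (e j) = dot (e j) (e j) / 2 * (i == j)%:R.
  have ej := root_dot_gt0 Phi_root (simple_root Delta_base j).
  have {1}-> : e j = (dot (e j) (e j) / 2) *: tnth cDelta j.
    rewrite tnth_map scalerA (_ : _ * _ = 1) ?scale1r //.
    by field; rewrite gt_eqF.
  rewrite linearZ /= (tnth_nth 0 cDelta) coord_free ?(basis_free coroots_basis) //.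
  by rewrite eq_sym.
have -> : cr a = (2 / dot a a) *: \sum_j coord Delta j a *: e j.
  by rewrite -(coord_sum Delta_base).
rewrite linearZ linear_sum /=.
rewrite (bigD1 i) //= big1 ?addr0 => [|j ji].
  by rewrite linearZ /= coordE eqxx mulr1; field; rewrite gt_eqF.
by rewrite linearZ /= coordE eq_sym (negbTE ji) !mulr0.
Qed.

Lemma coord_coroot_ge0 i a : a \in Phi ->
  (0 <= coord cDelta i (cr a)) = (0 <= coord Delta i a).
Proof.
move=> aP; have aa := root_dot_gt0 Phi_root aP.
have ei := root_dot_gt0 Phi_root (simple_root Delta_base i).
by rewrite coord_coroot // pmulr_lge0 ?divr_gt0.
Qed.

Lemma coroots_sign_base : sign_base (coroots dot Phi) cDelta.
Proof.
split; last 1 first.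
- move=> _ /mapP[a aP ->].
  case: (sign_base_sign Delta_base aP) => h; [left|right] => i.
    by rewrite coord_coroot_ge0 //; apply: h.
  rewrite -oppr_ge0 -linearN -corootN coord_coroot_ge0 ?(root_oppE Phi_root) //.
  by rewrite linearN oppr_ge0; apply: h.
- move=> _ /mapP[a aD ->]; rewrite mem_coroots.
  exact: (sign_base_sub Delta_base).
exact: coroots_basis.
Qed.

Lemma root_sign_coroot a : a \in Phi ->
  root_sign cDelta (cr a) = root_sign Delta a.
Proof.
move=> aP; rewrite /root_sign; congr (if _ then _ else _).
by apply: eq_forallb => i; rewrite coord_coroot_ge0.
Qed.

End DualSystem.

Section StrangeFormula.
Variables (R : realType) (V : vectType R) (dot : {dot V for idfun}).
Variables (Phi : seq V) (n : nat) (Delta : n.-tuple V).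
Hypotheses (Phi_root : root_system dot Phi) (Phi_uniq : uniq Phi).
Hypothesis Phi_irr : irreducible_roots dot Phi.
Hypothesis Delta_base : sign_base Phi Delta.
Implicit Types (a b x y z : V).

Local Notation refl := (reflection dot).
Local Notation cr := (coroot dot).
Local Notation e i := (tnth Delta i).
Local Notation cDelta := (map_tuple cr Delta).

Variables (alpha rho : V) (h : R).
Hypothesis alpha_max : highest_root Delta Phi alpha.
Hypothesis alpha_norm : dot alpha alpha = 2.
Hypothesis hE : h = 1 + height Delta alpha.
Hypothesis rho1 : forall i, dot rho (e i) = 1.

(** The factor is found at [x = y = alpha]: by [highest_root_sum] the left-hand
    side is there [<4 rho,alpha> + 4], that is [4 h]. *)
Lemma coxeter_form x y :
  \sum_(a <- Phi) 2 / dot a a * (dot x a * dot y a) = 2 * h * dot x y.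
Proof.
have [|k kE] := invariant_form Phi_root Phi_uniq Phi_irr (f := fun a => 2 / dot a a).
  by move=> a b _ _ /=; rewrite dot_reflection.
rewrite kE; congr (_ * _).
have cra : cr alpha = alpha.
  by rewrite /coroot alpha_norm divff ?pnatr_eq0 // scale1r.
suff : k * dot alpha alpha = 4 * h by rewrite alpha_norm => ?; lra.
rewrite -kE.
have -> : \sum_(a <- Phi) 2 / dot a a * (dot alpha a * dot alpha a) =
    \sum_(a <- Phi) dot a (cr alpha) * dot (cr a) alpha.
  by apply: eq_bigr => a _; rewrite cra dot_corootl (dotC dot alpha); ring.
rewrite (highest_root_sum Phi_root Phi_uniq Delta_base
  (F := fun a => dot (cr a) alpha)) //.
- have -> : \sum_(a <- Phi) root_sign Delta a * dot (cr a) alpha =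
     dot (\sum_(a <- Phi) root_sign Delta a *: cr a) alpha.
    by rewrite dot_suml; apply: eq_bigr => a _; rewrite dotZl.
  rewrite (sum_sign_coroot Phi_root Phi_uniq Delta_base rho1) dotZl.
  by rewrite -(height_dot Delta_base _ rho1) cra alpha_norm hE; ring.
- by move=> a; rewrite corootN dotNl.
by move=> a a0; rewrite dot_corootl a0 mulr0 mul0r.
Qed.

Variables (r g : R) (theta : V).
Hypothesis rE : lacing_ratio dot Phi r.
Hypothesis thetaP : theta \in Phi.
Hypothesis theta_max : highest_root cDelta (coroots dot Phi) (cr theta).
Hypothesis gE : g = 1 + height Delta theta.

(** The highest coroot is a longest one, so [theta] is a shortest root. *)
Lemma lacing_theta : r * dot theta theta = 2.
Proof.
have tt := root_dot_gt0 Phi_root thetaP.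
have theta_min a : a \in Phi -> dot theta theta <= dot a a.
  move=> aP; have aa := root_dot_gt0 Phi_root aP.
  have := highest_root_norm (coroots_root_system Phi_root)
    (coroots_sign_base Phi_root Delta_base) (coroots_irreducible Phi_root Phi_irr)
    theta_max (a := cr a).
  rewrite (mem_coroots dot) => /(_ aP).
  have nrm x : 0 < dot x x -> dot (cr x) (cr x) = 4 / dot x x.
    by move=> xx; rewrite !dotE; field; rewrite gt_eqF.
  by rewrite !nrm // ler_pM2l // lef_pV2 ?posrE.
move: rE; rewrite /lacing_ratio; case: ifPn => [/allP/(_ _ thetaP)/eqP -> ->|].
  by rewrite mul1r.
move=> /allPn[a aP]; rewrite {1}/long => an /(_ _ thetaP) E.
have an2 : dot a a < 2.
  by rewrite lt_neqAle an -alpha_norm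
    (highest_root_norm Phi_root Delta_base Phi_irr alpha_max aP).
have : ~~ long dot theta by rewrite /long lt_eqF // (le_lt_trans (theta_min a aP)).
move/E => /(congr1 (fun z => dot z theta)); rewrite dotZl dot_corootl => <-.
by rewrite mulfK // gt_eqF.
Qed.

(** The same computation as for [coxeter_form] in the dual root system, at the
    vector [theta], which is the coroot of the highest coroot. *)
Lemma dual_coxeter_form x y :
  \sum_(a <- Phi) 4 / dot a a ^+ 2 * (dot x a * dot y a) = 2 * r * g * dot x y.
Proof.
have [|k kE] := invariant_form Phi_root Phi_uniq Phi_irr
    (f := fun a => 4 / dot a a ^+ 2).
  by move=> a b _ _ /=; rewrite dot_reflection.
rewrite kE; congr (_ * _).
have tt := root_dot_gt0 Phi_root thetaP.
apply: (@mulIf _ (dot theta theta)); first by rewrite gt_eqF.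
have -> : 2 * r * g * dot theta theta = 2 * g * (r * dot theta theta) by ring.
rewrite lacing_theta -kE.
have -> : \sum_(a <- Phi) 4 / dot a a ^+ 2 * (dot theta a * dot theta a) =
    \sum_(c <- coroots dot Phi) dot c (cr (cr theta)) * dot c theta.
  rewrite big_map; apply: eq_big_seq => a aP; have aa := root_dot_gt0 Phi_root aP.
  by rewrite corootK !dotE (dotC dot theta); field; rewrite gt_eqF.
rewrite (highest_root_sum (coroots_root_system Phi_root)
  (coroots_uniq dot Phi_uniq) (coroots_sign_base Phi_root Delta_base)
  (F := fun c => dot c theta)) //.
- have -> : \sum_(c <- coroots dot Phi) root_sign cDelta c * dot c theta =
     dot (\sum_(a <- Phi) root_sign Delta a *: cr a) theta.
    rewrite big_map dot_suml; apply: eq_big_seq => a aP.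
    by rewrite dotZl (root_sign_coroot Phi_root Delta_base).
  rewrite (sum_sign_coroot Phi_root Phi_uniq Delta_base rho1) dotZl.
  rewrite -(height_dot Delta_base _ rho1) gE !dotE.
  by field; rewrite gt_eqF.
- exact: coroots_irreducible.
- by move=> c; rewrite dotNl.
move=> c /eqP; rewrite dotZr mulf_eq0 mulf_eq0 invr_eq0 pnatr_eq0 (gt_eqF tt).
by move/eqP.
Qed.

Variable omega : n.-tuple V.
Hypothesis omega_dual : forall i j, dot (tnth omega i) (e j) = (i == j)%:R.

Lemma card_roots : (size Phi)%:R = n%:R * h.
Proof.
have := form_trace Delta_base omega_dual coxeter_form.
have -> : \sum_(a <- Phi) 2 / dot a a * dot a a = \sum_(a <- Phi) 2.
  apply: eq_big_seq => a aP; have aa := root_dot_gt0 Phi_root aP.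
  by rewrite divfK // gt_eqF.
rewrite big_const_seq count_predT iter_addr_0 -mulr_natl; lra.
Qed.

(** The strange formula of Freudenthal and de Vries for the dual root system,
    in which [4 rho] is the signed sum of all roots, [2 r g] the factor of the
    second moment, and [n h] the number of roots. *)
Lemma strange_formula : dot rho rho = r * g * n%:R * (h + 1) / 12.
Proof.
have cP := coroots_root_system Phi_root.
have cB := coroots_sign_base Phi_root Delta_base.
have X4 : \sum_(c <- coroots dot Phi) root_sign cDelta c *: c = 4 *: rho.
  rewrite big_map -(sum_sign_coroot Phi_root Phi_uniq Delta_base rho1).
  by apply: eq_big_seq => a aP; rewrite (root_sign_coroot Phi_root Delta_base).
have norms : \sum_(c <- coroots dot Phi) dot c c = n%:R * (2 * r * g).
  rewrite -(form_trace Delta_base omega_dual dual_coxeter_form) big_map.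
  apply: eq_big_seq => a aP; have aa := root_dot_gt0 Phi_root aP.
  by rewrite !dotE; field; rewrite gt_eqF.
have form c : \sum_(d <- coroots dot Phi) dot c d ^+ 2 = 2 * r * g * dot c c.
  rewrite -dual_coxeter_form big_map.
  apply: eq_big_seq => a aP; have aa := root_dot_gt0 Phi_root aP.
  by rewrite !dotE; field; rewrite gt_eqF.
have := strange_sum cP (coroots_uniq dot Phi_uniq) (root_signN cP cB)
  (fun c _ => root_sign_sqr cDelta c) (fun c d => @root_sign_add _ _ _ _ _ _ cP cB c d)
  (fun c _ => form c).
by rewrite /= X4 norms size_map card_roots dotZl dotZr; lra.
Qed.

End StrangeFormula.

(** * The coroot lattice *)

Section CorootLattice.
Variables (R : realType) (V : vectType R) (dot : {dot V for idfun}).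
Variable Phi : seq V.
Hypothesis Phi_root : root_system dot Phi.
Implicit Types (a b x y z q : V).

Local Notation refl := (reflection dot).
Local Notation cr := (coroot dot).

(** As the roots come in opposite pairs, the integral combinations of coroots
    are the plain sums of coroots. *)
Definition coroot_sum q :=
  exists2 l, {subset l <= Phi} & q = \sum_(a <- l) cr a.

Lemma coroot_sum0 : coroot_sum 0.
Proof. by exists [::]; rewrite ?big_nil. Qed.

Lemma coroot_sumD q q' : coroot_sum q -> coroot_sum q' -> coroot_sum (q + q').
Proof.
move=> [l lP ->] [l' lP' ->]; exists (l ++ l'); last by rewrite big_cat.
by move=> a; rewrite mem_cat => /orP[/lP|/lP'].
Qed.

Lemma coroot_sumN q : coroot_sum q -> coroot_sum (- q).
Proof.
move=> [l lP ->]; exists (map -%R l).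
  by move=> _ /mapP[a /lP aP ->]; rewrite (root_oppE Phi_root).
by rewrite big_map -sumrN; apply: eq_bigr => a _; rewrite corootN.
Qed.

Lemma coroot_sumZ (c : R) q : c \is a Num.int -> coroot_sum q ->
  coroot_sum (c *: q).
Proof.
move=> /intrP[i ->] qL; rewrite scaler_int.
have nat_mul k : coroot_sum (q *+ k).
  by elim: k => [|k IH]; [exact: coroot_sum0|rewrite mulrS; apply: coroot_sumD].
by case: i => k; [exact: nat_mul|apply/coroot_sumN/nat_mul].
Qed.

Lemma coroot_sum_root a : a \in Phi -> coroot_sum (cr a).
Proof.
by move=> aP; exists [:: a]; rewrite ?big_seq1 // => b; rewrite inE => /eqP ->.
Qed.

Lemma coroot_sum_sum (I : eqType) (s : seq I) (P : pred I) (F : I -> V) :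
    (forall i, i \in s -> P i -> coroot_sum (F i)) ->
  coroot_sum (\sum_(i <- s | P i) F i).
Proof.
move=> FL; rewrite big_seq_cond; elim/big_ind: _ => [|x y|i].
- exact: coroot_sum0.
- exact: coroot_sumD.
by case/andP; apply: FL.
Qed.

Lemma coroot_latticeP q : coroot_lattice dot Phi q <-> coroot_sum q.
Proof.
split=> [[c ->]|[l lP ->]].
  apply: coroot_sum_sum => i _ _; rewrite -scaler_int.
  apply: coroot_sumZ; first exact: intr_int.
  have : (coroots dot Phi)`_i \in coroots dot Phi by rewrite mem_nth.
  by case/mapP=> a aP ->; apply: coroot_sum_root.
rewrite /coroot_lattice /=; elim: l lP => [|a l IH] lP.
  exists [ffun=> 0]; rewrite big_nil big1 // => i _.
  by rewrite ffunE mulr0z.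
have [|c Ec] := IH; first by move=> b bl; apply: lP; rewrite inE bl orbT.
have aC : cr a \in coroots dot Phi by rewrite map_f // lP // mem_head.
have lt : (index (cr a) (coroots dot Phi) < size (coroots dot Phi))%N.
  by rewrite index_mem.
exists [ffun i => c i + (i == Ordinal lt)%:Z].
rewrite big_cons Ec.
under [RHS]eq_bigr do rewrite ffunE mulrzDr.
rewrite big_split /= addrC; congr (_ + _).
rewrite (bigD1 (Ordinal lt)) //= eqxx mulr1z nth_index // big1 ?addr0 //.
by move=> i /negbTE ->; rewrite mulr0z.
Qed.

Lemma coroot_sum_pairing q a : coroot_sum q -> a \in Phi ->
  dot q a \is a Num.int.
Proof.
move=> [l lP ->] aP; rewrite dot_suml big_seq; apply: rpred_sum => b /lP bP.
by rewrite dotC; apply: (root_crystallographic Phi_root).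
Qed.

(** As [|q|^2] is the sum of the pairings of [q] with its terms, some term [b^v]
    pairs positively with [q], and then [<q,b> = 1].  Reflecting [q] in [b]
    removes this term and preserves the norm; after finitely many such steps no
    term is left. *)
Lemma minuscule_eq0 q : coroot_sum q ->
  (forall a, a \in Phi -> [\/ dot q a = 0, dot q a = 1 | dot q a = -1]) -> q = 0.
Proof.
case=> l; elim: {l}(size l) {-2}l (erefl (size l)) q => [|k IH] l.
  by move=> /size0nil -> q _ ->; rewrite big_nil.
move=> sz q lP Eq qmin; apply/eqP; apply: contraT => q0.
have [b bl qb] : exists2 b, b \in l & 0 < dot q (cr b).
  apply/hasP; apply: contraLR (dot_gt0 dot q0) => /hasPn h.
  rewrite -leNgt {2}Eq dot_sumr big_seq; apply: sumr_le0 => b bl.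
  by rewrite leNgt h.
have bP := lP b bl; have bb := root_dot_gt0 Phi_root bP.
have qb1 : dot q b = 1.
  move: qb; rewrite dot_coroot; case: (qmin b bP) => -> //.
    by rewrite mulr0 mul0r ltxx.
  by rewrite pmulr_lgt0 ?invr_gt0 // => h; lra.
have Er : refl b q = q - cr b.
  by rewrite /reflection dot_coroot qb1 mulr1.
have : refl b q = 0.
  apply: (IH (rem b l)).
  - by rewrite size_rem // sz.
  - by move=> c /mem_rem /lP.
  - by rewrite Er Eq (big_rem b) //= addrAC subrr add0r.
  move=> a aP; rewrite dot_reflection_adj; apply: qmin.
  exact: (root_reflection Phi_root).
move=> /(congr1 (fun x => dot x x)); rewrite dot_reflection dot0l => /eqP.
by rewrite dot_eq0 (negbTE q0).
Qed.

(** * The affine Weyl group *)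

(** The properties of the elements [g] of the affine Weyl group that the
    transport of the Sommers region uses.  The inverse [g'] is an argument so
    that the same properties can be asserted of it, by exchanging [g] and [g']. *)
Record affine_symmetry (g g' : V -> V) : Prop := AffineSymmetry {
  affine_symmetryK : cancel g g';
  affine_symmetryK' : cancel g' g;
  affine_symmetry_dist : forall x y, dot (g x - g y) (g x - g y) = dot (x - y) (x - y);
  affine_symmetry_root : forall a (k : int), a \in Phi ->
    exists2 b, b \in Phi &
      exists l : int, forall x, dot (g x) a + k%:~R = dot x b + l%:~R;
  affine_symmetry_lattice : forall q, coroot_sum q -> coroot_sum (g q)
}.

Definition affine_reflection a (k : int) x : V := x - (dot x a + k%:~R) *: cr a.

Lemma affine_reflectionE a k x : affine_reflection a k x = refl a x - k%:~R *: cr a.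
Proof.
rewrite /affine_reflection /reflection scalerDl opprD addrA; congr (_ - _ - _).
by rewrite /coroot dotZr !scalerA mulrC.
Qed.

Lemma affine_reflectionK a k : a \in Phi -> involutive (affine_reflection a k).
Proof.
move=> aP x; have aa := root_dot_gt0 Phi_root aP.
rewrite /affine_reflection !dotE.
rewrite -addrA -opprD -scalerDl [X in X *: _](_ : _ = 0) ?scale0r ?subr0 //.
by field; rewrite gt_eqF.
Qed.

Lemma affine_reflection_symmetry a k : a \in Phi ->
  affine_symmetry (affine_reflection a k) (affine_reflection a k).
Proof.
move=> aP; have aa := root_dot_gt0 Phi_root aP.
have K := affine_reflectionK k aP; split=> //.
- move=> x y; rewrite !affine_reflectionE opprB addrA subrK.
  by rewrite -linearB dot_reflection.
- move=> b l bP; have /intrP[j Ej] := root_crystallographic Phi_root aP bP.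
  exists (refl a b); first exact: (root_reflection Phi_root).
  exists (l - k * j) => x; rewrite affine_reflectionE dotDl dotNl dotZl.
  by rewrite dot_reflection_adj (dotC dot _ b) Ej intrD intrN intrM; ring.
move=> q qL; rewrite /affine_reflection.
apply: coroot_sumD => //; apply/coroot_sumN/coroot_sumZ; last exact: coroot_sum_root.
by rewrite rpredD ?intr_int // coroot_sum_pairing.
Qed.

Lemma affine_symmetry_id : affine_symmetry id id.
Proof. by split=> // a k aP; exists a => //; exists k. Qed.

Lemma affine_symmetry_comp f f' g g' :
  affine_symmetry f f' -> affine_symmetry g g' -> affine_symmetry (f \o g) (g' \o f').
Proof.
move=> [fK fK' fd fr fL] [gK gK' gd gr gL]; split=> /=.
- exact: can_comp.
- exact: can_comp.
- by move=> x y; rewrite fd gd.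
- move=> a k aP; have [b bP [l El]] := fr a k aP.
  have [c cP [m Em]] := gr b l bP.
  by exists c => //; exists m => x; rewrite El Em.
by move=> q /gL /fL.
Qed.

End CorootLattice.

(** * The fundamental alcove and the Sommers region *)

Section Alcove.
Variables (R : realType) (V : vectType R) (dot : {dot V for idfun}).
Variables (Phi : seq V) (n : nat) (Delta : n.-tuple V).
Hypotheses (Phi_root : root_system dot Phi) (Phi_uniq : uniq Phi).
Hypothesis Phi_irr : irreducible_roots dot Phi.
Hypothesis Delta_base : sign_base Phi Delta.
Hypothesis height_int : forall a, a \in Phi -> height Delta a \is a Num.int.
Implicit Types (a x y z q : V).

Local Notation refl := (reflection dot).
Local Notation cr := (coroot dot).
Local Notation e i := (tnth Delta i).

Variables (alpha rho : V) (h : nat).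
Hypothesis alpha_max : highest_root Delta Phi alpha.
Hypothesis alpha_norm : dot alpha alpha = 2.
Hypothesis hE : h%:R = 1 + height Delta alpha.
Hypothesis rho1 : forall i, dot rho (e i) = 1.

Let alphaP : alpha \in Phi := alpha_max.1.
Let alpha_dom := highest_dominant Phi_root Delta_base alpha_max.

Local Notation center := (h%:R^-1 *: rho).

Lemma coxeter_gt0 : 0 < h%:R :> R.
Proof.
have := height_gt0 Phi_root Delta_base alphaP
  (dominant_root_pos Phi_root Delta_base alphaP alpha_dom).
rewrite hE; lra.
Qed.

Lemma dot_center a : dot center a = height Delta a / h%:R.
Proof. by rewrite dotZl (height_dot Delta_base _ rho1) mulrC. Qed.

Lemma height_le a : a \in Phi -> height Delta a <= h%:R - 1.
Proof. by move=> aP; have := alpha_max.2 a aP; rewrite hE; lra. Qed.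

Lemma height_ge a : a \in Phi -> - (h%:R - 1) <= height Delta a.
Proof.
by move=> aP; have := height_le (root_opp Phi_root aP); rewrite heightN; lra.
Qed.

Lemma norm_form : exists2 k, 0 < k &
  forall x, \sum_(a <- Phi) dot x a ^+ 2 = k * dot x x.
Proof.
have [|k kE] := invariant_form Phi_root Phi_uniq Phi_irr (f := fun=> 1) => //.
have form x : \sum_(a <- Phi) dot x a ^+ 2 = k * dot x x.
  by rewrite -kE; apply: eq_bigr => a _; rewrite mul1r.
exists k => //; rewrite -(@pmulr_lgt0 _ (dot alpha alpha)); last first.
  by rewrite alpha_norm.
rewrite -form (bigD1_seq alpha) //= alpha_norm ltr_pwDl //.
  by rewrite exprn_gt0.
by apply: sumr_ge0 => a _; apply: sqr_ge0.
Qed.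

Definition integral_point x :=
  forall a, a \in Phi -> h%:R * dot x a \is a Num.int.

Definition regular_point x :=
  forall a, a \in Phi -> dot x a \isn't a Num.int.

Lemma affine_symmetry_integral g g' x : affine_symmetry dot Phi g g' ->
  integral_point x -> integral_point (g x).
Proof.
move=> gS xI a aP; have [b bP [l El]] := affine_symmetry_root gS 0 aP.
have := El x; rewrite addr0 => ->; rewrite mulrDr rpredD ?xI //.
by rewrite rpredM ?intr_int ?natr_int.
Qed.

Lemma affine_symmetry_regular g g' x : affine_symmetry dot Phi g g' ->
  regular_point x -> regular_point (g x).
Proof.
move=> gS xR a aP; have [b bP [l El]] := affine_symmetry_root gS 0 aP.
by have := El x; rewrite addr0 => ->; rewrite rpredDr ?intr_int // xR.
Qed.

(** The values [h <x,e i>] are positive integers whose combination with the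
    positive coefficients of the highest root is less than [h], which is one
    more than the sum of these coefficients. *)
Lemma integral_alcove x : integral_point x -> (forall i, 0 < dot x (e i)) ->
  dot x alpha < 1 -> x = center.
Proof.
move=> xI x0 x1; have h0 := coxeter_gt0.
have c0 := dominant_full_support Phi_root Delta_base Phi_irr alphaP alpha_dom.
have m1 i : 1 <= h%:R * dot x (e i).
  have /intrP[j Ej] := xI _ (simple_root Delta_base i).
  have : 0 < h%:R * dot x (e i) by rewrite mulr_gt0.
  by rewrite Ej ltr0z -[1]/(1%:~R) ler_int gtz0_ge1.
have top : h%:R * dot x alpha <= h%:R - 1.
  have /intrP[j Ej] := xI _ alphaP.
  have : h%:R * dot x alpha < h%:R by rewrite -[ltRHS]mulr1 ltr_pM2l.
  rewrite Ej -[h%:R]/(h%:Z%:~R) ltr_int => lt.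
  by rewrite -[1]/(1%:~R) -intrB ler_int; lia.
have sum_le : \sum_i coord Delta i alpha * (h%:R * dot x (e i) - 1) <= 0.
  have -> : \sum_i coord Delta i alpha * (h%:R * dot x (e i) - 1) =
      h%:R * dot x alpha - height Delta alpha.
    rewrite /height (dotC dot x) (dot_coord dot Delta_base) mulr_sumr -sumrB.
    by apply: eq_bigr => i _; rewrite (dotC dot x); ring.
  by move: top hE; lra.
have each i : h%:R * dot x (e i) = 1.
  have ge0 j : 0 <= coord Delta j alpha * (h%:R * dot x (e j) - 1).
    by rewrite mulr_ge0 ?subr_ge0 // ltW.
  have : \sum_i coord Delta i alpha * (h%:R * dot x (e i) - 1) == 0.
    by rewrite eq_le sum_le sumr_ge0.
  rewrite psumr_eq0 // => /allP/(_ i); rewrite mem_index_enum => /(_ isT).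
  by rewrite mulf_eq0 (gt_eqF (c0 i)) subr_eq0 => /eqP.
apply: (dot_basis_eq (dot := dot) (sign_base_basis Delta_base)) => i.
have hn : h%:R != 0 :> R by rewrite gt_eqF.
by apply: (mulfI hn); rewrite each dotZl rho1 mulr1 divff.
Qed.

(** The squared distance changes by [4 / |a|^2] times the product of the values
    of the affine root at [x] and at [center]. *)
Lemma affine_reflection_closer a (k : int) x : a \in Phi ->
  dot x a + k%:~R < 0 -> 0 < dot center a + k%:~R ->
  dot (affine_reflection dot a k x - center)
      (affine_reflection dot a k x - center) < dot (x - center) (x - center).
Proof.
move=> aP xa ca; have aa := root_dot_gt0 Phi_root aP.
rewrite -subr_lt0 /affine_reflection; set c := center in ca *; clearbody c.
have -> : dot (x - (dot x a + k%:~R) *: cr a - c)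
      (x - (dot x a + k%:~R) *: cr a - c) - dot (x - c) (x - c) =
   4 / dot a a * ((dot x a + k%:~R) * (dot c a + k%:~R)).
  rewrite !dotE (dotC dot a x) (dotC dot a c) (dotC dot c x).
  by field; rewrite gt_eqF.
by rewrite pmulr_rlt0 ?divr_gt0 // nmulr_rlt0.
Qed.

(** A multiple of the squared distance to [center] takes natural values on the
    orbit of [x], so the approach by reflections in the walls of the alcove
    stops. *)
Lemma affine_transport x : integral_point x -> regular_point x ->
  exists g g', [/\ affine_symmetry dot Phi g g', affine_symmetry dot Phi g' g &
                   g x = center].
Proof.
have [k0 k0_gt0 form] := norm_form; have h0 := coxeter_gt0.
pose D x := \sum_(a <- Phi) (h%:R * dot (x - center) a) ^+ 2.
have DE y : D y = h%:R ^+ 2 * k0 * dot (y - center) (y - center).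
  rewrite -mulrA -form mulr_sumr; apply: eq_bigr => a _; exact: exprMn.
have D_int y : integral_point y -> D y \is a Num.int.
  move=> yI; rewrite /D big_seq; apply: rpred_sum => a aP; apply: rpredX.
  rewrite dotDl dotNl mulrBr rpredB ?yI // dot_center mulrC divfK ?gt_eqF //.
  exact: height_int.
have [m] : exists m : nat, D x <= m%:R.
  have D0 : 0 <= D x by apply: sumr_ge0 => a _; apply: sqr_ge0.
  by exists (Num.bound (D x)); apply/ltW/archi_boundP.
elim: m x => [|m IH] x Dm xI xR.
  exists id, id; split; try exact: affine_symmetry_id.
  apply/eqP; rewrite -subr_eq0 -(dot_eq0 dot) eq_le dot_ge0 andbT.
  by rewrite -(@pmulr_rle0 _ (h%:R ^+ 2 * k0)) -?DE // mulr_gt0 ?exprn_gt0.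
have step a (k : int) : a \in Phi -> dot x a + k%:~R < 0 ->
    0 < dot center a + k%:~R ->
  exists g g', [/\ affine_symmetry dot Phi g g', affine_symmetry dot Phi g' g &
                   g x = center].
  move=> aP xa ca; pose s := affine_reflection dot a k.
  have sS : affine_symmetry dot Phi s s by apply: affine_reflection_symmetry.
  have sI := affine_symmetry_integral sS xI.
  have lt : D (s x) < D x.
    by rewrite !DE ltr_pM2l ?mulr_gt0 ?exprn_gt0 ?affine_reflection_closer.
  have [|g [g' [gS g'S Eg]]] := IH (s x) _ sI (affine_symmetry_regular sS xR).
    have /intrP[i Ei] := D_int _ sI; have /intrP[j Ej] := D_int _ xI.
    move: lt Dm; rewrite Ei Ej ltr_int -[m.+1%:R]/(m.+1%:Z%:~R) ler_int.
    by rewrite -[m%:R]/(m%:Z%:~R) ler_int; clear; lia.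
  exists (g \o s), (s \o g'); split=> //; exact: affine_symmetry_comp.
have nz a (k : int) : a \in Phi -> dot x a != k%:~R.
  by move=> aP; apply: contraNneq (xR a aP) => ->; apply: intr_int.
have [/existsP[i xi]|] := boolP [exists i, dot x (e i) < 0].
  apply: (step (e i) 0); rewrite ?addr0 ?(simple_root Delta_base) //.
  by rewrite dot_center (height_simple Delta_base) div1r invr_gt0.
rewrite negb_exists => /forallP x0.
have [xa|xa] := ltP (dot x alpha) 1; last first.
  apply: (step (- alpha) 1); rewrite ?(root_oppE Phi_root) // dotNr.
    have := nz alpha 1 alphaP; rewrite eq_sym => ne.
    have : 1 < dot x alpha by rewrite lt_neqAle ne.
    lra.
  rewrite dot_center addrC subr_gt0 ltr_pdivrMr // mul1r hE; lra.
exists id, id; split; try exact: affine_symmetry_id.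
apply: integral_alcove => // i.
by rewrite lt_def (nz _ 0) ?(simple_root Delta_base) //= leNgt x0.
Qed.


Variable b : nat.
Hypotheses (b_gt0 : (0 < b)%N) (coprime_hb : coprime h b).

Local Notation point := (b%:R *: center).

Lemma coxeter_gt1 : (1 < h)%N.
Proof.
rewrite -(ltr_nat R) hE ltrDl.
apply: (height_gt0 Phi_root Delta_base alphaP).
exact: (dominant_root_pos Phi_root Delta_base alphaP alpha_dom).
Qed.

Lemma height_neq0 a : a \in Phi -> height Delta a != 0.
Proof.
move=> aP; have [ap|an] := boolP (pos_root Delta a).
  by rewrite gt_eqF // (height_gt0 Phi_root Delta_base).
rewrite -oppr_eq0 -heightN gt_eqF // (height_gt0 Phi_root Delta_base) //.
  by rewrite (root_oppE Phi_root).
by rewrite (pos_rootN Phi_root Delta_base).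
Qed.

Lemma integral_point_mul : integral_point point.
Proof.
move=> a aP; have h0 := coxeter_gt0.
have -> : h%:R * dot point a = b%:R * height Delta a.
  by rewrite dotZl dot_center; field; rewrite gt_eqF.
by apply: rpredM; [exact: natr_int|exact: height_int].
Qed.

(** A value [b ht(a) / h] is not an integer, since [h] is prime to [b] and
    exceeds [|ht(a)|]. *)
Lemma regular_point_mul : regular_point point.
Proof.
move=> a aP; have h0 := coxeter_gt0; apply/negP => /intrP[k].
have le := height_le aP; have ge := height_ge aP; have ne := height_neq0 aP.
have /intrP[j Ej] := height_int aP.
rewrite dotZl dot_center Ej mulrA => /(canRL (divfK _)) E.
have {E} : b%:Z * j = k * h%:Z.
  by apply/eqP; rewrite -(eqr_int R) !intrM E // gt_eqF.
move: le ge ne; rewrite Ej -[h%:R]/(h%:Z%:~R) -[1]/(1%:~R) -intrB -intrN.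
rewrite !ler_int intr_eq0 => le ge ne E.
have : (h %| `|j|)%N.
  rewrite -(Gauss_dvdr _ coprime_hb); apply/dvdnP; exists `|k|%N.
  by rewrite -[b]/(absz b%:Z) -[in RHS](absz_nat h) -!abszM E.
move/dvdn_leq; rewrite absz_gt0 ne => /(_ isT).
by move: le ge ne coxeter_gt0; rewrite ltr0n; clear; lia.
Qed.

(** The affine roots of value [b / h] at [center] have height [b]: with
    [b = t h + c] they are the [<.,a> + t] with [a] of height [c] and the
    [<.,a> + t + 1] with [a] of height [c - h]. *)
Lemma sommersP q : sommers dot Delta Phi h b q <->
  forall a (k : int), a \in Phi -> dot center a + k%:~R = b%:R / h%:R ->
    0 <= dot q a + k%:~R.
Proof.
have h1 := coxeter_gt1; have h0 := coxeter_gt0.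
have r_lt : (b %% h < h)%N by rewrite ltn_mod; apply: ltnW.
have bE : b%:R = (b %/ h)%N%:R * h%:R + (b %% h)%N%:R :> R.
  by rewrite -natrM -natrD -divn_eq.
split=> [[lo hi] a k aP | S].
  rewrite dot_center => /(canRL (addrK _)) E.
  have {}E : height Delta a = b%:R - k%:~R * h%:R.
    by rewrite -[LHS](divfK (lt0r_neq0 h0)) E mulrBl divfK ?gt_eqF.
  have le := height_le aP; have ge := height_ge aP.
  have Ej : height Delta a = (b%:Z - k * h%:Z)%:~R by rewrite E intrB intrM.
  have bEz := divn_eq b h.
  have [kE|kE] : k = (b %/ h)%N%:Z \/ k = (b %/ h)%N%:Z + 1.
  - move: le ge; rewrite Ej -[h%:R]/(h%:Z%:~R) -[1]/(1%:~R) -intrB -intrN.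
    rewrite !ler_int; move: r_lt bEz h1; clear.
    move: (b %/ h)%N (b %% h)%N => t c ch -> h1 le ge.
    have : (k - t%:Z = 0) \/ (k - t%:Z = 1) by nia.
    by case=> ?; [left|right]; lia.
  - rewrite -[k%:~R]opprK subr_ge0 kE; apply: lo => //.
    by rewrite E kE bE -pmulrn; ring.
  have := hi (- a); rewrite (root_oppE Phi_root) heightN E => /(_ aP).
  rewrite dotNr kE intrD -[_%:Z%:~R]/((b %/ h)%N%:R) => le1.
  suff : - dot q a <= (b %/ h)%N%:R + 1 by lra.
  by apply: le1; rewrite bE natrB ?(ltnW r_lt) // -pmulrn; ring.
split=> a aP ha.
  have := S a (b %/ h)%N aP; rewrite dot_center ha -pmulrn.
  suff -> : (b %% h)%N%:R / h%:R + (b %/ h)%N%:R = b%:R / h%:R :> R.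
    by move=> /(_ erefl); lra.
  by rewrite bE; field; rewrite gt_eqF.
have := S (- a) ((b %/ h)%N%:Z + 1); rewrite (root_oppE Phi_root) => /(_ aP).
rewrite dot_center heightN ha intrD -pmulrn dotNr natrB ?(ltnW r_lt) //.
suff -> : - (h%:R - (b %% h)%N%:R) / h%:R + ((b %/ h)%N%:R + 1) = b%:R / h%:R :> R.
  by move=> /(_ erefl); lra.
by rewrite bE; field; rewrite gt_eqF.
Qed.

(** The affine symmetry carrying [center] to [point] turns the affine roots of
    value [b / h] at [center] into those of value [b / h] at [point]. *)
Lemma sommers_dilated g g' q : affine_symmetry dot Phi g g' -> g center = point ->
    sommers dot Delta Phi h b q ->
  dominant dot Delta (g q) /\ dot (g q) alpha <= b%:R.
Proof.
move=> gS gc /sommersP qS; have h0 := coxeter_gt0.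
have key a (k : int) : a \in Phi -> dot point a + k%:~R = b%:R / h%:R ->
    0 <= dot (g q) a + k%:~R.
  move=> aP Ep; have [c cP [l El]] := affine_symmetry_root gS k aP.
  by rewrite El qS // -El gc.
split=> [i|].
  rewrite -[X in _ <= X]addr0; apply: (key _ 0); rewrite ?(simple_root Delta_base) //.
  by rewrite dotZl dot_center (height_simple Delta_base) div1r addr0.
suff : 0 <= dot (g q) (- alpha) + b%:Z%:~R by rewrite dotNr -pmulrn; lra.
apply: key; first by rewrite (root_oppE Phi_root).
rewrite dotZl dot_center heightN -pmulrn.
have -> : height Delta alpha = h%:R - 1 by rewrite hE; ring.
by field; rewrite gt_eqF.
Qed.

(** An affine root of value [b / h] at [center] is carried by [g] to an affine
    root [<.,c> + l] with [b ht(c) + l h = b]; so [b] divides [l], and [l < 0]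
    would make [ht(c)] exceed [h]. *)
Lemma sommers_zero g g' : affine_symmetry dot Phi g g' -> g point = center ->
  sommers dot Delta Phi h b (g 0).
Proof.
move=> gS gp; have h0 := coxeter_gt0; apply/sommersP => a k aP.
have [c cP [l El]] := affine_symmetry_root gS k aP.
rewrite El dot0l add0r -gp El => E; rewrite ler0z.
move: E; rewrite dotZl dot_center.
have le := height_le cP; have /intrP[j Ej] := height_int cP.
rewrite Ej => E.
have {E} : b%:Z * j + l * h%:Z = b%:Z.
  apply/eqP; rewrite -(eqr_int R) intrD !intrM -!pmulrn.
  by apply/eqP; apply: (@mulIf _ h%:R^-1); rewrite ?invr_eq0 ?gt_eqF // -E;
    field; rewrite gt_eqF.
move=> E; have {E} E : l * h%:Z = (1 - j) * b%:Z.
  by rewrite mulrBl mul1r -{1}E; ring.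
have : (b %| `|l|)%N.
  rewrite -(@Gauss_dvdl b `|l|%N h) 1?coprime_sym //.
  by apply/dvdnP; exists `|1 - j|%N; have := congr1 absz E; rewrite !abszM.
case/dvdnP => m Em; rewrite leNgt; apply/negP => l0.
have El' : l = - (m%:Z * b%:Z) by move: Em l0; clear; lia.
have Eb : j = 1 + m%:Z * h%:Z.
  have b0 : b%:Z != 0 by rewrite eqz_nat -lt0n.
  by apply: (mulfI b0); move: E; rewrite El'; clear; lia.
have m0 : (0 < m)%N by move: l0; rewrite El'; clear; case: m => //; lia.
move: le; rewrite Ej Eb -[h%:R]/(h%:Z%:~R) -[1]/(1%:~R) -intrB ler_int.
by move: m0; clear; nia.
Qed.

Lemma sum_root_pos (U : zmodType) (F : V -> U) : (forall a, F (- a) = F a) ->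
  \sum_(a <- Phi) F a = (\sum_(a <- Phi | pos_root Delta a) F a) *+ 2.
Proof.
move=> FN; rewrite (bigID (pos_root Delta)) /= mulr2n; congr (_ + _).
rewrite big_mkcond -(sum_root_opp Phi_root Phi_uniq) [RHS]big_mkcond.
apply: eq_big_seq => a aP.
by rewrite (pos_rootN Phi_root Delta_base) // negbK FN.
Qed.

(** By [coxeter_form], [h z] is the combination of the positive coroots with
    the integral coefficients [<z,a>]. *)
Lemma coxeter_mul_lattice z : (forall a, a \in Phi -> dot z a \is a Num.int) ->
  coroot_sum dot Phi (h%:R *: z).
Proof.
move=> zI; have -> : h%:R *: z =
    \sum_(a <- Phi | pos_root Delta a) dot z a *: cr a.
  apply: (@scalerI _ _ 2); first by rewrite pnatr_eq0.
  rewrite [RHS]scaler_nat -(sum_root_pos (F := fun a => dot z a *: cr a)).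
    apply: (dot_basis_eq (dot := dot) (sign_base_basis Delta_base)) => i.
    rewrite scalerA dotZl dot_suml.
    rewrite -(coxeter_form Phi_root Phi_uniq Phi_irr Delta_base alpha_max
      alpha_norm hE rho1).
    by apply: eq_bigr => a _; rewrite dotZl dot_corootl (dotC dot a); ring.
  by move=> a; rewrite corootN dotNr scalerN scaleNr opprK.
apply: coroot_sum_sum => a aP _.
by apply: coroot_sumZ; rewrite ?zI //; apply: coroot_sum_root.
Qed.

(** Both sides are sums over the roots; on the dilated alcove every root takes
    values in [[-b, b]], so the inequality holds term by term.  In the case of
    equality all values are 0 or [b] up to sign, so [y / b] is a minuscule
    coweight; it lies in the coroot lattice together with its multiples by the
    coprime [b] and [h], hence vanishes. *)
Lemma dilated_alcove_norm y : coroot_sum dot Phi y -> dominant dot Delta y ->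
    dot y alpha <= b%:R ->
  h%:R * dot y y <= 2 * b%:R * dot rho y ?= iff (y == 0).
Proof.
move=> yL yd yb.
have bpos : 0 < b%:R :> R by rewrite ltr0n.
have pos_bound a : a \in Phi -> pos_root Delta a -> 0 <= dot y a <= b%:R.
  move=> aP ap; rewrite (dominant_dot_ge0 Delta_base yd ap) /= (le_trans _ yb) //.
  exact: (highest_root_max Phi_root Delta_base Phi_irr alpha_max yd aP).
pose u a := root_sign Delta a * dot y a.
have u_bound a : a \in Phi -> 0 <= u a <= b%:R.
  move=> aP; rewrite /u /root_sign; case: ifPn => ap.
    by rewrite mul1r pos_bound.
  have := pos_bound (- a); rewrite (root_oppE Phi_root).
  by rewrite (pos_rootN Phi_root Delta_base) // dotNr mulN1r; apply.
pose d := 2 * b%:R * dot rho y - h%:R * dot y y.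
have dE : 2 * d = \sum_(a <- Phi) 2 / dot a a * (u a * (b%:R - u a)).
  have -> : 2 * d = b%:R * dot (4 *: rho) y - 2 * h%:R * dot y y.
    by rewrite /d dotZl; ring.
  rewrite -(coxeter_form Phi_root Phi_uniq Phi_irr Delta_base alpha_max
      alpha_norm hE rho1).
  rewrite -(sum_sign_coroot Phi_root Phi_uniq Delta_base rho1) dot_suml.
  rewrite mulr_sumr -sumrB; apply: eq_bigr => a _; rewrite dotZl dot_corootl /u.
  have := root_sign_sqr Delta a; rewrite expr2 => s2.
  rewrite (dotC dot a y) mulrBr [X in _ = _ * (_ - X)]mulrACA s2 mul1r; ring.
have term_ge0 a : a \in Phi -> 0 <= 2 / dot a a * (u a * (b%:R - u a)).
  move=> aP; have /andP[u0 ub] := u_bound a aP.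
  have aa := root_dot_gt0 Phi_root aP.
  by rewrite mulr_ge0 ?divr_ge0 ?(ltW aa) // mulr_ge0 // subr_ge0.
have d0 : 0 <= 2 * d.
  by rewrite dE big_seq; apply: sumr_ge0 => a aP; apply: term_ge0.
split; first by rewrite -subr_ge0 -/d; move: d0; lra.
apply/eqP/eqP => [Eq|->]; last by rewrite !dotE; ring.
have {Eq} /eqP : 2 * d = 0 by rewrite /d Eq; ring.
rewrite dE big_seq psumr_eq0 // => /allP d_eq0.
pose z := b%:R^-1 *: y.
have yz : y = b%:R *: z by rewrite /z scalerA divff ?scale1r // gt_eqF.
have zmin a : a \in Phi -> [\/ dot z a = 0, dot z a = 1 | dot z a = -1].
  move=> aP; have aa := root_dot_gt0 Phi_root aP.
  have := d_eq0 a aP; rewrite aP /= mulf_eq0 mulf_eq0 invr_eq0 (gt_eqF aa).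
  rewrite pnatr_eq0 /= mulf_eq0 /u /root_sign subr_eq0 /z dotZl.
  case: ifP => _; rewrite ?mul1r ?mulN1r => /orP[]/eqP E.
  - by constructor 1; rewrite E mulr0.
  - by constructor 2; rewrite -E mulVf // gt_eqF.
  - by constructor 1; rewrite -[dot y a]opprK E oppr0 mulr0.
  by constructor 3; rewrite -[dot y a]opprK -E mulrN mulVf // gt_eqF.
have zI a : a \in Phi -> dot z a \is a Num.int.
  by case/zmin=> ->; rewrite ?rpredN ?rpred0 ?rpred1.
clearbody z; have hzL := coxeter_mul_lattice zI.
have zL : coroot_sum dot Phi z.
  have /coprimezP[[m k] /= E] : coprimez h%:Z b%:Z by rewrite /coprimez.
  have -> : z = m%:~R *: (h%:R *: z) + k%:~R *: y.
    rewrite yz !scalerA -scalerDl (_ : _ + _ = 1) ?scale1r //.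
    by have := congr1 (fun t : int => t%:~R : R) E; rewrite intrD !intrM.
  by apply: coroot_sumD; apply: (coroot_sumZ Phi_root); rewrite ?intr_int.
by rewrite yz (minuscule_eq0 Phi_root zL zmin) scaler0.
Qed.

End Alcove.

(** * The maximum of the size *)

Section Maximum.
Variables (R : realType) (V : vectType R) (dot : {dot V for idfun}).
Variables (Phi : seq V) (n : nat) (Delta : n.-tuple V).

Lemma root_system_undup : root_system dot Phi -> root_system dot (undup Phi).
Proof.
case=> nz sp refl crys red; split; rewrite ?mem_undup //.
- by rewrite -sp; apply: eq_span; apply: mem_undup.
- by move=> a b; rewrite !mem_undup; apply: refl.
- by move=> a b; rewrite !mem_undup; apply: crys.
by move=> a c; rewrite !mem_undup; apply: red.
Qed.

Lemma irreducible_roots_undup :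
  irreducible_roots dot Phi -> irreducible_roots dot (undup Phi).
Proof.
move=> [[a aP] irr]; split; first by exists a; rewrite mem_undup.
move=> P [b bP Pb] [c cP Pc]; rewrite !mem_undup in bP cP.
have [||x [y [xP Px yP Py xy]]] := irr P; [by exists b|by exists c|].
by exists x, y; split; rewrite ?mem_undup.
Qed.

Lemma simple_roots_sign_base : simple_roots Delta Phi -> sign_base Phi Delta.
Proof.
case=> sub bas sgn; split=> // a /sgn[] h; [left|right] => i.
  exact: natr_ge0 (h i).
by rewrite -oppr_ge0; apply: natr_ge0 (h i).
Qed.

Lemma simple_roots_height_int a : simple_roots Delta Phi -> a \in Phi ->
  height Delta a \is a Num.int.
Proof.
move=> simp /(simple_sign simp)[] h; apply: rpred_sum => i _.
  exact: intr_nat.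
by rewrite -rpredN; apply: intr_nat.
Qed.

End Maximum.

Theorem theorem6p3 (R : realType) (V : vectType R) (dot : {dot V for idfun})
    (n : nat) (Phi : seq V) (Delta : n.-tuple V)
    (root_Phi : root_system dot Phi) (irr_Phi : irreducible_roots dot Phi)
    (simple_Delta : simple_roots Delta Phi)
    (alpha_tilde : V) (highest_alpha : highest_root Delta Phi alpha_tilde)
    (alpha_normalized : dot alpha_tilde alpha_tilde = 2)
    (h : nat) (coxeter_h : h%:R = 1 + height Delta alpha_tilde)
    (r : R) (ratio_r : lacing_ratio dot Phi r)
    (theta : V) (theta_Phi : theta \in Phi)
    (highest_theta : highest_root (map_tuple (coroot dot) Delta)
                       (coroots dot Phi) (coroot dot theta))
    (g_check : R) (dual_coxeter : g_check = 1 + height Delta theta)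
    (omega : n.-tuple V) (coweights : fundamental_coweights dot Delta omega)
    (b : nat) (b_gt0 : (0 < b)%N) (coprime_hb : coprime h b) :
  let region := sommers dot Delta Phi h b `&` coroot_lattice dot Phi in
  let size := size_check dot h (rho_check omega) in
  let m := r * g_check / h%:R
           * (n%:R * (b%:R ^+ 2 - 1) * (h%:R + 1) / 24) in
  is_maximum (size @` region) m /\
  exists! q_star, region q_star /\ size q_star = m.
Proof.
move=> region size m.
(* repetitions are removed for the sums over the roots *)
pose Psi := undup Phi; have PsiE : Psi =i Phi by apply: mem_undup.
have Psi_root : root_system dot Psi by apply: root_system_undup.
have Psi_uniq : uniq Psi by apply: undup_uniq.
have Psi_irr : irreducible_roots dot Psi by apply: irreducible_roots_undup.
have base : sign_base Psi Delta.
  have [sub bas sgn] := simple_roots_sign_base simple_Delta.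
  by split=> // a; rewrite PsiE; [apply: sub|apply: sgn].
have height_int a : a \in Psi -> height Delta a \is a Num.int.
  by rewrite PsiE; apply: simple_roots_height_int.
have alpha_max : highest_root Delta Psi alpha_tilde.
  by case: highest_alpha => aP amax; split=> [|c]; rewrite PsiE //; apply: amax.
set rho := rho_check omega in size *.
have dual := coweights.2.
have rho1 i : dot rho (tnth Delta i) = 1.
  rewrite /rho /rho_check dot_suml (bigD1 i) //= dual eqxx big1 ?addr0 // => j.
  by move=> /negbTE ji; rewrite dual ji.
have lacing : lacing_ratio dot Psi r.
  move: ratio_r; rewrite /lacing_ratio (eq_all_r PsiE).
  by case: ifP => // _ rE a; rewrite PsiE; apply: rE.
have theta_max : highest_root (map_tuple (coroot dot) Delta)
    (coroots dot Psi) (coroot dot theta).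
  have cE c : (c \in coroots dot Psi) = (c \in coroots dot Phi).
    exact: (eq_mem_map _ PsiE).
  by case: highest_theta => tP tmax; split=> [|c]; rewrite cE //; apply: tmax.
have thetaP : theta \in Psi by rewrite PsiE.
have strange := strange_formula Psi_root Psi_uniq Psi_irr base alpha_max
  alpha_normalized coxeter_h rho1 lacing thetaP theta_max dual_coxeter dual.
have h0 : 0 < h%:R :> R by apply: (coxeter_gt0 Psi_root base alpha_max coxeter_h).
have latE q : coroot_lattice dot Phi q <-> coroot_sum dot Psi q.
  rewrite (coroot_latticeP root_Phi); split=> -[l lP ->]; exists l => // a /lP;
    by rewrite PsiE.
have somE q : sommers dot Delta Phi h b q <-> sommers dot Delta Psi h b q.
  by split=> -[lo hi]; split=> a aP; [apply: lo|apply: hi|apply: lo|apply: hi];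
    move: aP; rewrite PsiE.
have [g [g' [gS g'S gp]]] := affine_transport Psi_root Psi_uniq Psi_irr base
  height_int alpha_max alpha_normalized coxeter_h rho1
  (integral_point_mul Psi_root base height_int alpha_max coxeter_h rho1 b)
  (regular_point_mul Psi_root base height_int alpha_max coxeter_h rho1 coprime_hb).
have g'c : g' (h%:R^-1 *: rho) = b%:R *: (h%:R^-1 *: rho).
  by rewrite -{1}gp (affine_symmetryK gS).
(* completing the square at the centre of the alcove *)
have sizeE q : size q =
    m - (2 * b%:R * dot rho (g' q) - h%:R * dot (g' q) (g' q)) / 2.
  have := affine_symmetry_dist g'S q (h%:R^-1 *: rho).
  rewrite g'c /size /size_check /m; move: (g' q) => y.
  rewrite !(dotDl, dotDr, dotNl, dotNr, dotZl, dotZr).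
  rewrite (dotC dot q rho) (dotC dot y rho) => E.
  have -> : r * g_check / h%:R * (n%:R * (b%:R ^+ 2 - 1) * (h%:R + 1) / 24) =
      (b%:R ^+ 2 - 1) * dot rho rho / (2 * h%:R).
    by rewrite strange; field; rewrite gt_eqF.
  set X := (X in _ = X); move: E; set A := (X in X = _); set B := (X in _ = X).
  move=> E; suff -> : X = h%:R / 2 * (A - B) + (h%:R / 2 * dot q q - dot rho q).
    by rewrite E subrr mulr0 add0r; ring.
  by rewrite /X /A /B; field; rewrite gt_eqF.
have bound q : region q ->
    h%:R * dot (g' q) (g' q) <= 2 * b%:R * dot rho (g' q) ?= iff (g' q == 0).
  move=> [/somE qS /latE qL].
  have [yd yb] := sommers_dilated Psi_root base alpha_max coxeter_h rho1 g'S g'c qS.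
  apply: (dilated_alcove_norm Psi_root Psi_uniq Psi_irr base alpha_max
    alpha_normalized coxeter_h rho1 b_gt0 coprime_hb) => //.
  exact: affine_symmetry_lattice g'S _ qL.
have q0_region : region (g 0).
  split; [apply/somE|apply/latE].
    exact: (sommers_zero Psi_root base height_int alpha_max coxeter_h rho1
      b_gt0 coprime_hb gS gp).
  by apply: (affine_symmetry_lattice gS); apply: coroot_sum0.
have q0_size : size (g 0) = m.
  by rewrite sizeE (affine_symmetryK gS) !dotE; ring.
split.
  split; first by exists (g 0).
  by move=> _ [q qr <-]; rewrite sizeE; have := (bound q qr).1; lra.
exists (g 0); split=> // q [qr]; rewrite sizeE => qm.
have /eqP : g' q == 0 by rewrite -(bound q qr).2; apply/eqP; lra.
by move/(congr1 g); rewrite (affine_symmetryK' gS).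
Qed.
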